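(* Let $F_n=f_n\circ\cdots\circ f_1$, $n\in\mathbb{N}$, be a contracting forward composition of centred inner functions $f_n$, and let $(I_n)$ be any shrinking target. Then \[ \{\zeta\in\partial\mathbb{D}: (F_n(\zeta))\text{ hits }(I_n)\} \] has either full measure or zero measure in $\partial\mathbb{D}$.
   Context: $\mathbb{D}=\{z\in\mathbb{C}:|z|<1\}$. An inner function is a holomorphic map $f:\mathbb{D}\to\mathbb{D}$ whose radial boundary extension (also denoted $f$, defined at almost every point of $\partial\mathbb{D}$) takes values in $\partial\mathbb{D}$ almost everywhere. An inner function $f$ is centred if $f(0)=0$. Compositions on the boundary are compositions of radial boundary extensions, defined almost everywhere. Measure on $\partial\mathbb{D}$ is arc length (Lebesgue) measure. The sequence $(F_n)$ is contracting if the hyperbolic distance in $\mathbb{D}$ between $F_n(z)$ and $F_n(z')$ tends to $0$ as $n\to\infty$ for any (equivalently, every) pair of distinct points $z,z'\in\mathbb{D}$. For forward compositions of centred inner functions this is equivalent to $\sum_{n=1}^\infty(1-|f_n'(0)|)=\infty$. A target is a sequence $(I_n)_{n\in\mathbb{N}}$ of arcs of $\partial\mathbb{D}$, not necessarily nested and not necessarily shrinking in length; it is a shrinking target if $|I_n|\to0$ as $n\to\infty$, where $|I_n|$ is the length of $I_n$. For $\zeta\in\partial\mathbb{D}$, $(F_n(\zeta))$ hits $(I_n)$ if $F_n(\zeta)\in I_n$ for infinitely many $n$. *)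

(* Defs.v *)
(* MathComp-Analysis, over an arbitrary R : realType.  The complex plane is
   R[i]^o: the alias ^o makes R[i] carry the topology given by its modulus and
   the structure of a normed module over itself, so that [derivable f z 1] is
   complex differentiability of f at z. *)
From mathcomp Require Import all_boot all_order all_algebra.
From mathcomp Require Import all_classical all_reals all_analysis.
From mathcomp Require Import complex.

Set Implicit Arguments.
Unset Strict Implicit.
Unset Printing Implicit Defensive.

Import Order.TTheory GRing.Theory Num.Theory.
Import numFieldNormedType.Exports.

Local Open Scope classical_set_scope.
Local Open Scope ring_scope.
Local Open Scope complex_scope.

Section Defs.
Context {R : realType}.
Local Notation C := (R[i])^o.

Definition unit_disc : set C := [set z | `|z| < 1].

Definition unit_circle : set C := [set z | `|z| = 1].

Definition expi (t : R) : C := cos t +i* sin t.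

Definition circle_angles (A : set C) : set R :=
  [set t | 0 <= t < 2 * pi /\ A (expi t)].

(* Arc length measure of A `&` unit_circle. *)
Definition arc_length (A : set C) : \bar R :=
  lebesgue_measure (circle_angles A).

(* A `&` unit_circle is contained in a Borel set of zero arc length. *)
Definition circle_null (A : set C) : Prop :=
  lebesgue_measure.-negligible (circle_angles A).

(* Arcs may contain both, one or none of their end points. *)
Definition is_arc (A : set C) : Prop :=
  exists (a b : R) (la lb : bool),
    a < b <= a + 2 * pi /\
    A = expi @` [set` Interval (BSide la a) (BSide lb b)].

(* Where the radial limit does not exist, [lim] is the default point 0 of C;
   for an inner function this affects only a null set of zeta. *)
Definition radial_ext (f : C -> C) (zeta : C) : C :=
  lim (f (r%:C * zeta) @[r --> (1 : R)^'-]).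

Definition inner (f : C -> C) : Prop :=
  [/\ forall z, unit_disc z -> derivable f z 1,
      forall z, unit_disc z -> unit_disc (f z) &
      circle_null [set zeta | ~ (cvg (f (r%:C * zeta) @[r --> (1 : R)^'-]) /\
                                 unit_circle (radial_ext f zeta))]].

Definition centred (f : C -> C) : Prop := f 0 = 0.

(* Indices start at 0: fwd_comp f n = f n \o ... \o f 0. *)
Fixpoint fwd_comp (f : nat -> C -> C) (n : nat) : C -> C :=
  if n is m.+1 then f n \o fwd_comp f m else f 0%N.

(* Distance for the hyperbolic metric 2 |dz| / (1 - |z|^2) on the disc. *)
Definition hyp_dist (z w : C) : R :=
  let rho := complex.Re `|(z - w) / (1 - (w : R[i])^* * z)| in
  ln ((1 + rho) / (1 - rho)).

Definition contracting (F : nat -> C -> C) : Prop :=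
  forall z w, unit_disc z -> unit_disc w -> z <> w ->
    hyp_dist (F n z) (F n w) @[n --> \oo] --> (0 : R).

Definition shrinking_target (I : nat -> set C) : Prop :=
  (forall n, is_arc (I n)) /\ arc_length (I n) @[n --> \oo] --> 0%E.

Definition hits (x : nat -> C) (I : nat -> set C) : Prop :=
  forall N : nat, exists2 n : nat, (N <= n)%N & I n (x n).

(* The orbit of zeta is taken under the compositions of the radial boundary
   extensions. *)
Definition hitting_set (f : nat -> C -> C) (I : nat -> set C) : set C :=
  [set zeta | unit_circle zeta /\
     hits (fun n => fwd_comp (fun k => radial_ext (f k)) n zeta) I].

End Defs.

(* Main.v *)
Require Import Defs.
From mathcomp Require Import all_boot all_order all_algebra.
From mathcomp Require Import all_classical all_reals all_analysis.
From mathcomp Require Import complex measurable_realfun.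
From mathcomp Require Import ring lra.
Import Order.TTheory GRing.Theory Num.Theory.
Import numFieldNormedType.Exports.
Set Implicit Arguments.
Unset Strict Implicit.
Unset Printing Implicit Defensive.
Local Open Scope classical_set_scope.
Local Open Scope ring_scope.
Local Open Scope complex_scope.

(* Let p_z be the Poisson kernel of the disc.  If f is inner then, for every
   Borel set A of the circle, the integral of 1_A o f against p_z is that of 1_A
   against p_(f z): the measures A |-> int 1_A o f p_z and A |-> int 1_A p_(f z)
   have the same moments, by Poisson's formula for the bounded holomorphic
   functions f^k and z^k, whose boundary values are radial limits.

   Let B_m be the set of the points whose orbit under f_m, f_(m+1), ... hits
   the target infinitely often.  Then 1_(B_0) = 1_(B_(n+1)) o F_n almost everywhere,
   so that the harmonic function u(z) = int 1_(B_0) p_z equals int 1_(B_(n+1)) p_(F_n z).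
   Contraction gives F_n(z) --> 0 = F_n(0), hence u(z) - u(0) is at most
   int |p_(F_n z) - p_0| --> 0: u is constant, and 1_(B_0) is almost everywhere
   constant. *)

(** * Goursat's theorem *)

Section rectangle_integrals.
Context {R : realType}.
Notation mu := (@lebesgue_measure R).

(** Derivability is only pointwise, with no continuity of the derivative, so Cauchy's theorem has to
    start from Goursat's bisection. Of each contour integral only the imaginary part is followed: in
    the coordinate log w, the vertical sides of a rectangle carry exactly the circle integrals of
    the real part. Poisson's formula at an arbitrary z comes from a mean value property that
    tolerates one exceptional point, applied to f - f z times an extension of the kernel; no change
    of variable moves z to 0. Equality of moments reaches Borel sets by a closure argument:
    polynomials in trigonometric polynomials converge boundedly to indicators. That constancy of u
    forces 1_(B_0) to be constant is read on Fourier coefficients, not on radial limits of u. Radial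
    extensions make sense only almost everywhere; orbits are therefore followed with total
    measurable maps of angles, under which preimages of null sets are null because every f n fixes
    0, where the Poisson kernel is 1. *)

Lemma integrable_segment (a b : R) (f : R -> R) :
  {within `[a, b], continuous f} -> mu.-integrable `[a, b] (EFin \o f).
Proof.
by apply: continuous_compact_integrable; exact: segment_compact.
Qed.

Lemma Rintegral_split (a b c : R) (f : R -> R) : a <= b -> b <= c ->
  {within `[a, c], continuous f} ->
  \int[mu]_(x in `[a, c]) f x =
  \int[mu]_(x in `[a, b]) f x + \int[mu]_(x in `[b, c]) f x.
Proof.
move=> ab bc cf; have itf := integrable_segment cf.
have itb : mu.-integrable `]b, c] (EFin \o f).
  by apply: integrableS itf => //; apply: subset_itvr; rewrite bnd_simp.
rewrite -[X in _ = _ + X](Rintegral_itv_obnd_cbnd itb).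
by rewrite -(Rintegral_itvB itf) ?bnd_simp// addrC subrK.
Qed.

Lemma Rintegral_near_cst (a b c K : R) (f : R -> R) : a <= b ->
  {within `[a, b], continuous f} ->
  (forall t, a <= t <= b -> `|f t - c| <= K) ->
  `|\int[mu]_(x in `[a, b]) f x - c * (b - a)| <= K * (b - a).
Proof.
move=> ab cf fK.
have itf := integrable_segment cf.
have cst (k : R) : mu.-integrable `[a, b] (EFin \o cst k).
  by apply: integrable_segment => x; exact: cvg_cst.
have len (k : R) : \int[mu]_(x in `[a, b]) k = k * (b - a).
  rewrite Rintegral_cst//= lebesgue_measure_itv/= lte_fin.
  by case: ltgtP ab => // -> _; rewrite subrr.
rewrite -len -RintegralB//; last exact: cst.
have itfc : mu.-integrable `[a, b] (EFin \o (fun t => f t - c)).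
  have := integrableB (mu := mu) (measurable_itv `[a, b]) itf (cst c).
  exact: eq_integrable.
apply: (le_trans (le_normr_Rintegral _ _)) => //.
rewrite -len; apply: le_Rintegral => //; [exact: (integrable_norm itfc)|exact: cst].
Qed.


(* [U + iV] is complex differentiable at [x + iy], with derivative [a + ib]. *)
Definition cr_diff (U V : R -> R -> R) (x y : R) := exists a b : R,
  forall e, 0 < e -> exists2 d, 0 < d & forall h k, `|h| <= d -> `|k| <= d ->
    `|U (x + h) (y + k) - U x y - (a * h - b * k)| <= e * (`|h| + `|k|) /\
    `|V (x + h) (y + k) - V x y - (b * h + a * k)| <= e * (`|h| + `|k|).

Lemma cr_diff_cvg U V x y : cr_diff U V x y ->
  forall e, 0 < e -> exists2 d, 0 < d & forall h k, `|h| <= d -> `|k| <= d ->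
    `|U (x + h) (y + k) - U x y| <= e /\ `|V (x + h) (y + k) - V x y| <= e.
Proof.
move=> [a [b ab]] e e0; have [d d0 dP] := ab _ ltr01.
have K0 : 0 < 2 * (`|a| + `|b| + 1) by have := normr_ge0 a; have := normr_ge0 b; lra.
exists (Num.min d (e / (2 * (`|a| + `|b| + 1)))).
  by rewrite lt_min d0 divr_gt0.
move=> h k; rewrite !le_min => /andP[hd he] /andP[kd ke].
have [H1 H2] := dP h k hd kd.
rewrite ler_pdivlMr// in he; rewrite ler_pdivlMr// in ke.
have A0 := normr_ge0 a; have B0 := normr_ge0 b.
have bnd (u w : R) : `|u - w| <= `|h| + `|k| ->
    `|w| <= `|a| * `|h| + `|b| * `|k| \/ `|w| <= `|b| * `|h| + `|a| * `|k| ->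
    `|u| <= e.
  move=> uw wl; apply: (@le_trans _ _ (`|u - w| + `|w|)).
    by rewrite -{1}(subrK w u); exact: ler_normD.
  have := normr_ge0 h; have := normr_ge0 k.
  by case: wl => wl; nra.
split.
  apply: (bnd _ (a * h - b * k)); first by move: H1; rewrite mul1r.
  by left; rewrite -!normrM; apply: ler_normB.
apply: (bnd _ (b * h + a * k)); first by move: H2; rewrite mul1r.
by right; rewrite -!normrM; apply: ler_normD.
Qed.

(** The form (U + iV)(dx + i dy) has imaginary part V dx + U dy, so [V] is integrated along
    horizontal sides and [U] along vertical ones; these are the two continuities to provide. *)
Lemma cr_diff_continuousl U V x y : cr_diff U V x y ->
  {for x, continuous (V^~ y)}.
Proof.
move=> /cr_diff_cvg UV; apply/cvgrPdist_le => e /UV[d d0 dP].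
near=> t; have td : `|t - x| <= d.
  by rewrite distrC; near: t; exists d => //= t /= /ltW.
have d0' : `|0 : R| <= d by rewrite normr0 ltW.
by have [_] := dP _ _ td d0'; rewrite addr0 [x + _]addrC subrK distrC.
Unshelve. all: by end_near. Qed.

Lemma cr_diff_continuousr U V x y : cr_diff U V x y ->
  {for y, continuous (U x)}.
Proof.
move=> /cr_diff_cvg UV; apply/cvgrPdist_le => e /UV[d d0 dP].
near=> t; have td : `|t - y| <= d.
  by rewrite distrC; near: t; exists d => //= t /= /ltW.
have d0' : `|0 : R| <= d by rewrite normr0 ltW.
by have [+ _] := dP _ _ d0' td; rewrite addr0 [y + _]addrC subrK distrC.
Unshelve. all: by end_near. Qed.


Section rectangle.
Variables (U V : R -> R -> R) (A B : R).
Hypothesis UV : forall x y, A < x < B -> cr_diff U V x y.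

(* Imaginary part of the integral of [U + iV] along the boundary of
   [x, x + w] x [y, y + h]. *)
Definition rectangle_integral (x y w h : R) : R :=
  \int[mu]_(t in `[y, y + h]) U (x + w) t - \int[mu]_(t in `[y, y + h]) U x t -
  (\int[mu]_(s in `[x, x + w]) V s (y + h) - \int[mu]_(s in `[x, x + w]) V s y).

Lemma within_U x a b : A < x < B -> {within `[a, b], continuous (U x)}.
Proof.
by move=> xAB; apply: continuous_subspaceT => t; exact: cr_diff_continuousr (UV t xAB).
Qed.

Lemma within_V y a b : A < a -> b < B -> {within `[a, b], continuous (V^~ y)}.
Proof.
move=> Aa bB; apply: continuous_in_subspaceT => s; rewrite inE/= in_itv/= => /andP[al bl].
have sAB : A < s < B by apply/andP; split; lra.
exact: cr_diff_continuousl (UV y sAB).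
Qed.

(** The inner sides cancel, so the four quarters add up to the whole and one of them reaches the
    average modulus. *)
Lemma rectangle_integral_quarter x y w h : A < x -> x + w < B -> 0 <= w -> 0 <= h ->
  exists x' y', [/\ x' = x \/ x' = x + w / 2, y' = y \/ y' = y + h / 2 &
    `|rectangle_integral x y w h| <= 4 * `|rectangle_integral x' y' (w / 2) (h / 2)|].
Proof.
move=> Ax xB w0 h0.
pose w2 := w / 2; pose h2 := h / 2.
have xw : x + w = x + w2 + w2 by rewrite /w2; lra.
have yh : y + h = y + h2 + h2 by rewrite /h2; lra.
have [w20 h20] : 0 <= w2 /\ 0 <= h2 by rewrite /w2 /h2; split; lra.
have sU z : A < z < B -> \int[mu]_(t in `[y, y + h]) U z t =
    \int[mu]_(t in `[y, y + h2]) U z t + \int[mu]_(t in `[y + h2, y + h2 + h2]) U z t.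
  by move=> zAB; rewrite yh; apply: Rintegral_split; [lra|lra|exact: within_U].
have sV z : \int[mu]_(t in `[x, x + w]) V t z =
    \int[mu]_(t in `[x, x + w2]) V t z + \int[mu]_(t in `[x + w2, x + w2 + w2]) V t z.
  by rewrite xw; apply: Rintegral_split; [lra|lra|apply: within_V; lra].
have E : rectangle_integral x y w h =
    rectangle_integral x y w2 h2 + rectangle_integral (x + w2) y w2 h2 +
    rectangle_integral x (y + h2) w2 h2 + rectangle_integral (x + w2) (y + h2) w2 h2.
  rewrite /rectangle_integral !sU ?sV; [|by apply/andP; split; lra..].
  by rewrite -xw -yh; ring.
set I1 := rectangle_integral x y w2 h2 in E.
set I2 := rectangle_integral (x + w2) y w2 h2 in E.
set I3 := rectangle_integral x (y + h2) w2 h2 in E.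
set I4 := rectangle_integral (x + w2) (y + h2) w2 h2 in E.
have [L1|L1] := leP `|rectangle_integral x y w h| (4 * `|I1|).
  by exists x, y; split; [left|left|].
have [L2|L2] := leP `|rectangle_integral x y w h| (4 * `|I2|).
  by exists (x + w2), y; split; [right|left|].
have [L3|L3] := leP `|rectangle_integral x y w h| (4 * `|I3|).
  by exists x, (y + h2); split; [left|right|].
have [L4|L4] := leP `|rectangle_integral x y w h| (4 * `|I4|).
  by exists (x + w2), (y + h2); split; [right|right|].
exfalso.
have : `|rectangle_integral x y w h| <= `|I1| + `|I2| + `|I3| + `|I4|.
  rewrite E; apply: (le_trans (ler_normD _ _)); rewrite lerD2r.
  by apply: (le_trans (ler_normD _ _)); rewrite lerD2r ler_normD.
by lra.
Qed.

(** The affine part contributes a * w * h through the vertical sides and the same amount through the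
    horizontal ones, and cancels thanks to the Cauchy-Riemann pattern of its coefficients. Each side
    brings an error [e] per unit of length. *)
Lemma rectangle_integral_le x y w h p q a b e :
  A < x -> x + w < B -> 0 <= w -> 0 <= h ->
  x <= p <= x + w -> y <= q <= y + h ->
  (forall s t, x <= s <= x + w -> y <= t <= y + h ->
    `|U s t - U p q - (a * (s - p) - b * (t - q))| <= e /\
    `|V s t - V p q - (b * (s - p) + a * (t - q))| <= e) ->
  `|rectangle_integral x y w h| <= 2 * e * (w + h).
Proof.
move=> Ax xB w0 h0 px qy H.
have yh : y <= y + h by lra.
have xw : x <= x + w by lra.
have [x1 x2] : x <= x <= x + w /\ x <= x + w <= x + w by split; apply/andP; split; lra.
have [y1 y2] : y <= y <= y + h /\ y <= y + h <= y + h by split; apply/andP; split; lra.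
have cU z : A < z < B -> {within `[y, y + h], continuous (U z)} by exact: within_U.
have cV z : {within `[x, x + w], continuous (V^~ z)} by exact: within_V.
have iU z : A < z < B -> mu.-integrable `[y, y + h] (EFin \o U z).
  by move=> zAB; apply: integrable_segment; exact: cU.
have iV z : mu.-integrable `[x, x + w] (EFin \o V^~ z).
  by apply: integrable_segment; exact: cV.
rewrite /rectangle_integral -RintegralB//=; [|by apply: iU; apply/andP; split; lra..].
rewrite -RintegralB//=.
have ehU : `|\int[mu]_(t in `[y, y + h]) (U (x + w) t - U x t) - a * w * (y + h - y)| <= 2 * e * (y + h - y).
  apply: Rintegral_near_cst => //.
    by move=> t; apply: cvgB; apply: cU; apply/andP; split; lra.
  move=> t ty.
  have [A1 _] := H x t x1 ty; have [A2 _] := H (x + w) t x2 ty.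
  by move: A1 A2; rewrite !ler_norml; lra.
have ehV : `|\int[mu]_(s in `[x, x + w]) (V s (y + h) - V s y) - a * h * (x + w - x)| <= 2 * e * (x + w - x).
  apply: Rintegral_near_cst => //.
    by move=> t; apply: cvgB; apply: cV.
  move=> t tx.
  have [_ A1] := H t y tx y1; have [_ A2] := H t (y + h) tx y2.
  by move: A1 A2; rewrite !ler_norml; lra.
by move: ehU ehV; rewrite !ler_norml; lra.
Qed.

End rectangle.

End rectangle_integrals.

Section goursat.
Context {R : realType}.
Notation mu := (@lebesgue_measure R).

Lemma nested_intervals (a l : nat -> R) :
  (forall n, a n <= a n.+1) -> (forall n, a n.+1 + l n.+1 <= a n + l n) ->
  (forall n, 0 <= l n) -> exists p, forall n, a n <= p <= a n + l n.
Proof.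
move=> ai al l0.
have aw m n : (m <= n)%N -> a m <= a n /\ a n + l n <= a m + l m.
  elim: n => [|n IH]; first by rewrite leqn0 => /eqP ->.
  rewrite leq_eqVlt => /predU1P[->//|]; rewrite ltnS => /IH[H1 H2].
  by split; [exact: le_trans H1 (ai n)|exact: le_trans (al n) H2].
have aub m n : a m <= a n + l n.
  have [mn|/ltnW mn] := leqP m n.
    by rewrite (le_trans (aw _ _ mn).1)// lerDl.
  by rewrite (le_trans _ (aw _ _ mn).2)// lerDl.
exists (sup (range a)) => n; apply/andP; split.
  apply: ub_le_sup; last by exists n.
  by exists (a n + l n) => _ [m _ <-]; exact: aub.
apply: ge_sup; first by exists (a n), n.
by move=> _ [m _ <-]; exact: aub.
Qed.

Lemma half_pow_le (l d : R) : 0 < d -> exists n, l / 2 ^+ n <= d.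
Proof.
move=> d0; exists (Num.truncn (`|l| / d)).+1.
rewrite ler_pdivrMr ?exprn_gt0// (le_trans (ler_norm l))//.
rewrite mulrC -ler_pdivrMr//.
have := truncnS_gt (`|l| / d) => /ltW /le_trans; apply.
by rewrite -natrX ler_nat ltnW// ltn_expl.
Qed.

(* Goursat's bisection: some quarter of the rectangle always carries at least
   a quarter of the integral, while near the limit point [U + iV] is affine up
   to an error negligible with respect to the size of the rectangle. *)
Theorem rectangle_integral0 (U V : R -> R -> R) (A B x y w h : R) :
  (forall x y, A < x < B -> cr_diff U V x y) ->
  A < x -> x + w < B -> 0 <= w -> 0 <= h -> rectangle_integral U V x y w h = 0.
Proof.
move=> UV Ax xB w0 h0.
pose Phi n (p : R * R) := rectangle_integral U V p.1 p.2 (w / 2 ^+ n) (h / 2 ^+ n).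
have half n (l : R) : l / 2 ^+ n.+1 = l / 2 ^+ n / 2.
  by rewrite exprSr invfM mulrA.
have pw_ge0 n (l : R) : 0 <= l -> 0 <= l / 2 ^+ n by move=> l0; rewrite divr_ge0.
have step (np : nat * (R * R)) : exists q : R * R,
    A < np.2.1 -> np.2.1 + w / 2 ^+ np.1 < B ->
    [/\ q.1 = np.2.1 \/ q.1 = np.2.1 + w / 2 ^+ np.1.+1,
        q.2 = np.2.2 \/ q.2 = np.2.2 + h / 2 ^+ np.1.+1 &
        `|Phi np.1 np.2| <= 4 * `|Phi np.1.+1 q|].
  have [/andP[Ap pB]|np_out] := boolP ((A < np.2.1) && (np.2.1 + w / 2 ^+ np.1 < B)).
    have [x' [y' H]] := rectangle_integral_quarter UV np.2.2 Ap pB (pw_ge0 np.1 w w0) (pw_ge0 np.1 h h0).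
    by exists (x', y') => _ _; rewrite /Phi /= !half.
  by exists (0, 0) => Ap pB; rewrite Ap pB in np_out.
have [F FP] := choice step.
pose P := fix P n := if n is m.+1 then F (m, P m) else (x, y).
have Pin n : x <= (P n).1 /\ (P n).1 + w / 2 ^+ n <= x + w.
  elim: n => [|n [H1 H2]]; first by rewrite /= expr0 divr1.
  have [||H _ _] /= := FP (n, P n); [exact: lt_le_trans H1|exact: le_lt_trans xB|].
  rewrite half in H *; have := pw_ge0 n w w0.
  by case: H => -> ; split; lra.
have PF n : [/\ (P n.+1).1 = (P n).1 \/ (P n.+1).1 = (P n).1 + w / 2 ^+ n.+1,
        (P n.+1).2 = (P n).2 \/ (P n.+1).2 = (P n).2 + h / 2 ^+ n.+1 &
        `|Phi n (P n)| <= 4 * `|Phi n.+1 (P n.+1)|].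
  have [H1 H2] := Pin n.
  by apply: (FP (n, P n)); [exact: lt_le_trans H1|exact: le_lt_trans xB].
have PhiP n : `|rectangle_integral U V x y w h| <= 4 ^+ n * `|Phi n (P n)|.
  elim: n => [|n IH]; first by rewrite /Phi /= expr0 !divr1 mul1r.
  apply: le_trans IH _; rewrite exprSr -mulrA ler_wpM2l ?exprn_ge0//.
  by have [] := PF n.
have [p pP] : exists p, forall n, (P n).1 <= p <= (P n).1 + w / 2 ^+ n.
  apply: nested_intervals => n.
  - by have W := pw_ge0 n.+1 w w0; have [+ _ _] := PF n; case=> ->; lra.
  - by have W := pw_ge0 n w w0; have [+ _ _] := PF n; rewrite half; case=> ->; lra.
  - exact: pw_ge0.
have [q qP] : exists q, forall n, (P n).2 <= q <= (P n).2 + h / 2 ^+ n.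
  apply: nested_intervals => n.
  - by have W := pw_ge0 n.+1 h h0; have [_ + _] := PF n; case=> ->; lra.
  - by have W := pw_ge0 n h h0; have [_ + _] := PF n; rewrite half; case=> ->; lra.
  - exact: pw_ge0.
have pAB : A < p < B.
  by have /andP[/= p1 p2] := pP 0%N; rewrite expr0 divr1 in p2; apply/andP; split; lra.
have [a [b ab]] := UV _ q pAB.
apply/eqP; rewrite -normr_eq0 eq_le normr_ge0 andbT leNgt; apply/negP => c0.
set c := `|rectangle_integral U V x y w h| in c0 PhiP *.
(* The bisection will give c <= 2 * e * (w + h)^2, the factor 4^n being compensated by the halving
   of both sides. The added 1 keeps the denominator positive and makes this inequality impossible
   when c > 0. *)
pose e := c / (2 * (w + h) ^+ 2 + 1).
have D0 : 0 < 2 * (w + h) ^+ 2 + 1 by have := sqr_ge0 (w + h); lra.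
have e0 : 0 < e by rewrite divr_gt0.
have [d d0 dP] := ab _ e0.
have [n nd] := half_pow_le (w + h) d0.
pose wn := w / 2 ^+ n; pose hn := h / 2 ^+ n.
have whn : wn + hn <= d by rewrite -mulrDl.
have wn0 : 0 <= wn by exact: pw_ge0.
have hn0 : 0 <= hn by exact: pw_ge0.
have [xP Px] := Pin n.
have /andP[p1 p2] := pP n; have /andP[q1 q2] := qP n.
rewrite -/wn in Px p2; rewrite -/hn in q2.
have : `|Phi n (P n)| <= 2 * (e * (wn + hn)) * (wn + hn).
  apply: (rectangle_integral_le (a := a) (b := b) (p := p) (q := q) UV) => //; [exact: lt_le_trans Ax xP|exact: le_lt_trans Px xB|].
  rewrite -/wn -/hn => s t sP tP.
  have sd : `|s - p| <= d by rewrite ler_norml; lra.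
  have td : `|t - q| <= d by rewrite ler_norml; lra.
  have := dP _ _ sd td; rewrite ![_ + (_ - _)]addrC !subrK => -[H1 H2].
  have le : e * (`|s - p| + `|t - q|) <= e * (wn + hn).
    by rewrite ler_pM2l// lerD// ler_norml; lra.
  by split; [exact: le_trans H1 le|exact: le_trans H2 le].
move=> H2.
have := ler_wpM2l (exprn_ge0 n (ler0n R 4)) H2 => /(le_trans (PhiP n)).
have -> : 4 ^+ n * (2 * (e * (wn + hn)) * (wn + hn)) = 2 * e * (w + h) ^+ 2.
  rewrite /wn /hn (_ : 4 = 2 ^+ 2); last by ring.
  by rewrite -exprM mulnC exprM; field; rewrite expf_neq0.
rewrite /e => H.
have : c * (2 * (w + h) ^+ 2 + 1) <= c * (2 * (w + h) ^+ 2).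
  move: H; rewrite mulrAC mulrA ler_pdivlMr// => H.
  by rewrite (le_trans H)//; lra.
by rewrite ler_pM2l//; lra.
Qed.

End goursat.

(** * Modulus and argument *)

Section complex_plane.
Context {R : realType}.
Notation C := (R[i])^o.
Implicit Types (z w : C) (x y r t : R).

Lemma complex_ext z w :
  complex.Re z = complex.Re w -> complex.Im z = complex.Im w -> z = w.
Proof. by case: z w => [a b] [c d] /= -> ->. Qed.

Lemma ReB z w : complex.Re (z - w) = complex.Re z - complex.Re w.
Proof. by case: z w => [a b] [c d]. Qed.

Lemma ImB z w : complex.Im (z - w) = complex.Im z - complex.Im w.
Proof. by case: z w => [a b] [c d]. Qed.

Definition cabs z : R := complex.Re `|z : R[i]|.

Lemma normcE z : `|z| = (cabs z)%:C.
Proof. by rewrite /cabs RRe_real// normr_real. Qed.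

Lemma cabsE z : cabs z = Num.sqrt (complex.Re z ^+ 2 + complex.Im z ^+ 2).
Proof. by rewrite /cabs normc_def. Qed.

Lemma cabs_ge0 z : 0 <= cabs z.
Proof. by rewrite cabsE sqrtr_ge0. Qed.

Lemma cabs_sqr z : cabs z ^+ 2 = complex.Re z ^+ 2 + complex.Im z ^+ 2.
Proof. by rewrite cabsE sqr_sqrtr// addr_ge0 ?sqr_ge0. Qed.

Lemma cabsD z w : cabs (z + w) <= cabs z + cabs w.
Proof. by rewrite -lecR rmorphD/= -!normcE ler_normD. Qed.

Lemma cabsM z w : cabs (z * w) = cabs z * cabs w.
Proof. by apply: (@complexI R); rewrite rmorphM/= -!normcE normrM. Qed.

Lemma cabsN z : cabs (- z) = cabs z.
Proof. by rewrite /cabs normrN. Qed.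

Lemma cabs0 : cabs 0 = 0.
Proof. by rewrite /cabs normr0. Qed.

Lemma cabs1 : cabs 1 = 1.
Proof. by rewrite /cabs normr1. Qed.

Lemma cabsX z n : cabs (z ^+ n) = cabs z ^+ n.
Proof. by elim: n => [|n IH]; rewrite ?expr0 ?cabs1// !exprS cabsM IH. Qed.

Lemma cabsV z : cabs z^-1 = (cabs z)^-1.
Proof. by apply: (@complexI R); rewrite -normcE normfV normcE [RHS]fmorphV. Qed.

Definition cj z : C := complex.Re z -i* complex.Im z.

Lemma cabsJ z : cabs (cj z) = cabs z.
Proof. by rewrite !cabsE /= sqrrN. Qed.

Lemma cjZ x z : cj (x%:C * z) = x%:C * cj z.
Proof. by apply: complex_ext; case: z => a b /=; ring. Qed.

Lemma cabsR x : cabs x%:C = `|x|.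
Proof. by rewrite cabsE /= expr0n addr0 sqrtr_sqr. Qed.

Lemma cabs_eq0 z : (cabs z == 0) = (z == 0).
Proof. by rewrite -[RHS]normr_eq0 normcE [in RHS]eq_complex /= eqxx andbT. Qed.

Lemma cabsB z w : cabs (z - w) = cabs (w - z).
Proof. by rewrite -cabsN opprB. Qed.

Lemma cabs_ge_sub z w : cabs z - cabs w <= cabs (z - w).
Proof. by rewrite lerBlDr (le_trans _ (cabsD _ _))// subrK. Qed.

Lemma normr_Re_le z : `|complex.Re z| <= cabs z.
Proof. by rewrite cabsE -sqrtr_sqr ler_wsqrtr// lerDl sqr_ge0. Qed.

Lemma normr_Im_le z : `|complex.Im z| <= cabs z.
Proof. by rewrite cabsE -sqrtr_sqr ler_wsqrtr// lerDr sqr_ge0. Qed.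

Lemma cabs_le_ReIm z : cabs z <= `|complex.Re z| + `|complex.Im z|.
Proof.
rewrite cabsE -(@ler_pXn2r _ 2) ?nnegrE ?sqrtr_ge0 ?addr_ge0//.
rewrite sqr_sqrtr ?addr_ge0 ?sqr_ge0// sqrrD !real_normK ?num_real//.
by rewrite lerD2r lerDl mulrn_wge0// mulr_ge0.
Qed.

Lemma unit_discE z : unit_disc z <-> cabs z < 1.
Proof. by rewrite /unit_disc /= normcE -ltcR. Qed.

Lemma unit_circleE z : unit_circle z <-> cabs z = 1.
Proof.
rewrite /unit_circle /= normcE; split => [|->//].
by move=> /(congr1 (@complex.Re R)).
Qed.

(** Radii in [C] are themselves complex numbers; a positive one has zero imaginary part, so real
    radii suffice. *)
Lemma cvgC_cabs (T : Type) (F : set_system T) {FF : Filter F} (g : T -> C) (l : C) :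
  g x @[x --> F] --> l <->
  forall e, 0 < e -> \forall x \near F, cabs (g x - l) < e.
Proof.
split => [/cvgrPdist_lt H e e0|H].
  have /H : 0 < e%:C :> R[i] by rewrite ltcR.
  by apply: filterS => x; rewrite normcE ltcR cabsB.
apply/cvgrPdist_lt => e; rewrite ltcE => /andP[/eqP ei e0].
apply: filterS (H _ e0) => x; rewrite cabsB => xe.
by rewrite normcE ltcE /= ei eqxx.
Qed.

Lemma cabs_expi t : cabs (expi t) = 1.
Proof. by rewrite cabsE /= cos2Dsin2 sqrtr1. Qed.

Lemma expiD x y : expi (x + y) = expi x * expi y.
Proof.
by apply: complex_ext; rewrite /= ?cosD ?sinD//; ring.
Qed.

Lemma expi0 : expi 0 = 1 :> C.
Proof. by rewrite /expi cos0 sin0. Qed.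

Lemma expi_neq0 t : expi t != 0 :> C.
Proof. by rewrite -cabs_eq0 cabs_expi oner_eq0. Qed.

Lemma expiX t n : expi t ^+ n = expi (t *+ n).
Proof.
by elim: n => [|n IH]; rewrite ?expr0 ?mulr0n ?expi0// exprS IH mulrS expiD.
Qed.

Lemma expiD2pi t : expi (t + 2 * pi) = expi t.
Proof.
by rewrite /expi mulr_natl cosD2pi sinD2pi.
Qed.

Lemma expiD2pin t n : expi (t + 2 * pi * n%:R) = expi t.
Proof.
elim: n => [|n IH]; first by rewrite mulr0 addr0.
by rewrite -(natr1 n) mulrDr mulr1 addrA expiD2pi.
Qed.

Lemma expiD2piz t (k : int) : expi (t + 2 * pi * k%:~R) = expi t.
Proof.
case: k => n; first exact: expiD2pin.
by rewrite NegzE -(expiD2pin _ n.+1) intrN mulrN subrK.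
Qed.

Definition angle z : R :=
  if 0 <= complex.Im z then acos (complex.Re z) else 2 * pi - acos (complex.Re z).

Lemma angle_expi t : 0 <= t < 2 * pi -> angle (expi t) = t.
Proof.
move=> /andP[t0 t2]; rewrite /angle /=.
have [tp|tp] := leP t pi.
  by rewrite sin_ge0_pi ?t0// cosK// in_itv/= t0.
have s : sin t < 0.
  rewrite -[t](subrK pi) sinDpi oppr_lt0; apply: sin_gt0_pi.
  by rewrite subr_gt0 tp ltrBlDr -mulr2n -mulr_natl.
rewrite leNgt s /= -(cosN t) -(cosD2pi (- t)) -mulr_natl cosK ?in_itv/=; lra.
Qed.

Lemma angle_itv z : cabs z = 1 -> 0 <= angle z < 2 * pi.
Proof.
move=> z1; have := normr_Re_le z; rewrite z1 ler_norml => Rez.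
have := pi_gt0 R.
rewrite /angle; case: ifPn => [_|Imz].
  by have := acos_ge0 Rez; have := acos_lepi Rez; lra.
have /acos_gt0 : -1 <= complex.Re z < 1.
  move/andP: Rez => [-> Rz] /=; rewrite lt_neqAle Rz andbT.
  apply: contraNneq Imz => Rz1; have := cabs_sqr z.
  rewrite z1 Rz1 expr1n => /esym/eqP; rewrite -subr_eq0 addrC addKr sqrf_eq0.
  by move=> /eqP ->.
by have := acos_lepi Rez; lra.
Qed.

Lemma expi_angle z : cabs z = 1 -> expi (angle z) = z.
Proof.
move=> z1; have Rez := normr_Re_le z; rewrite z1 ler_norml in Rez.
have Imz : complex.Im z ^+ 2 = 1 - complex.Re z ^+ 2.
  by have := cabs_sqr z; rewrite z1 expr1n => ->; rewrite addrC addKr.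
apply: complex_ext; rewrite /= /angle; case: ifPn => I0.
- by rewrite acosK ?in_itv.
- by rewrite addrC mulr_natl cosD2pi cosN acosK ?in_itv.
- by rewrite sin_acos// -Imz sqrtr_sqr ger0_norm.
- rewrite addrC mulr_natl sinD2pi sinN sin_acos//.
  by rewrite -Imz sqrtr_sqr ltr0_norm ?opprK// ltNge.
Qed.

Lemma expi_inj x y : 0 <= x < 2 * pi -> 0 <= y < 2 * pi -> expi x = expi y -> x = y.
Proof. by move=> /angle_expi {2}<- /angle_expi {2}<- ->. Qed.

End complex_plane.

(** * Cauchy-Riemann equations in the coordinate log w *)

Section polar_coordinates.
Context {R : realType}.
Notation C := (R[i])^o.
Notation mu := (@lebesgue_measure R).
Implicit Types (z w : C) (x y r t : R) (G : C -> C).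

Lemma derivable_affine G z : derivable G z 1 ->
  exists c : C, forall e : R, 0 < e -> exists2 d : R, 0 < d &
    forall h : C, cabs h < d -> cabs (G (z + h) - G z - c * h) <= e * cabs h.
Proof.
move=> /cvg_ex[c /cvgC_cabs Gc]; exists c => e /Gc /nbhs_ballP[d d0 dP].
move: d0 => /=; rewrite ltcE => /andP[/eqP di d0].
exists (complex.Re d) => // h hd.
have [->|h0] := eqVneq h 0; first by rewrite mulr0 addr0 subr0 subrr !cabs0 mulr0.
have : cabs (h^-1 *: (G (h *: (1 : C) + z) - G z) - c) < e.
  apply: (dP h) => //; rewrite -ball_normE /= sub0r normrN normcE ltcE /=.
  by rewrite di eqxx hd.
have -> : h *: (1 : C) = h by exact: mulr1.
rewrite [h + z]addrC => /ltW H.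
have -> : G (z + h) - G z - c * h = h * (h^-1 *: (G (z + h) - G z) - c).
  rewrite mulrBr [c * h]mulrC; congr (_ - _).
  by rewrite [RHS]mulrA mulfV// mul1r.
by rewrite cabsM mulrC ler_wpM2r ?cabs_ge0.
Qed.

(** Continuity along an arbitrary filter, so as to serve for sequences of radii, for the parameter
    of a circle and for radial limits alike. *)
Lemma derivable_cvg G z (T : Type) (F : set_system T) {FF : Filter F} (g : T -> C) :
  derivable G z 1 -> g x @[x --> F] --> z -> G (g x) @[x --> F] --> G z.
Proof.
move=> /derivable_affine[c Gc] /cvgC_cabs gz; apply/cvgC_cabs => e e0.
have [d d0 dP] := Gc _ ltr01.
have K0 : 0 < cabs c + 1 by have := cabs_ge0 c; lra.
near=> x.
have gd : cabs (g x - z) < d by near: x; exact: gz.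
have ge : cabs (g x - z) < e / (cabs c + 1) by near: x; apply: gz; exact: divr_gt0.
have := dP _ gd; rewrite [z + _]addrC subrK mul1r => H.
have -> : G (g x) - G z = (G (g x) - G z - c * (g x - z)) + c * (g x - z) by rewrite subrK.
apply: (le_lt_trans (cabsD _ _)); rewrite cabsM.
rewrite ltr_pdivlMr// in ge.
by apply: le_lt_trans ge; rewrite [leRHS]mulrDr mulr1 [leRHS]addrC lerD// mulrC.
Unshelve. all: by end_near. Qed.

Lemma is_derive_affine (f : R -> R) x (l : R) : is_derive x 1 f l ->
  forall e, 0 < e -> exists2 d, 0 < d &
    forall h, `|h| <= d -> `|f (x + h) - f x - l * h| <= e * `|h|.
Proof.
move=> [df <-]; have := df; rewrite /derive => /cvg_ex[c dc]; have -> := cvg_lim _ dc => //.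
move/cvgrPdist_le : dc => dc e /dc /nbhs_ballP[d /= d0 dP].
exists (d / 2) => [|h hd]; first by rewrite divr_gt0.
have [->|h0] := eqVneq h 0; first by rewrite mulr0 addr0 subr0 subrr normr0 mulr0.
have : `|c - h^-1 *: (f (h *: (1 : R) + x) - f x)| <= e.
  apply: (dP h) => //; rewrite -ball_normE /= sub0r normrN.
  by rewrite (le_lt_trans hd)//; lra.
have -> : h *: (1 : R) = h by exact: mulr1.
rewrite [h + x]addrC distrC => H.
have -> : f (x + h) - f x - c * h = h * (h^-1 *: (f (x + h) - f x) - c).
  by rewrite mulrBr [c * h]mulrC [h * (_ *: _)]mulrA mulfV// mul1r.
by rewrite normrM mulrC ler_wpM2r.
Qed.

Lemma expi_exp_affine (e : R) : 0 < e -> exists2 d, 0 < d & forall h k, `|h| <= d -> `|k| <= d ->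
  cabs ((expR h)%:C * expi k - 1 - (h +i* k)) <= e * (`|h| + `|k|).
Proof.
(* The real and imaginary errors below add up to at most 5 * e4 * |k| + e4 * |h|. The bound 1 lets
   products of small quantities be absorbed, and |h| <= e4 / 2 gives |exp h - 1| <= e4. *)
move=> e0; pose e4 := Num.min 1 (e / 8).
have e40 : 0 < e4 by rewrite lt_min ltr01 divr_gt0.
have [e41 e44] : e4 <= 1 /\ 8 * e4 <= e.
  have : e4 <= e4 by []. 
  rewrite {2}/e4 le_min => /andP[? H]; split=> //.
  by move: H; rewrite ler_pdivlMr// mulrC.
have [d1 d10 d1P] := is_derive_affine (is_derive_expR (0 : R)) e40.
have [d2 d20 d2P] := is_derive_affine (is_derive_cos (0 : R)) e40.
have [d3 d30 d3P] := is_derive_affine (is_derive_sin (0 : R)) e40.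
exists (Num.min (Num.min d1 (e4 / 2)) (Num.min d2 d3)).
  by rewrite !lt_min d10 d20 d30 divr_gt0.
move=> h k; rewrite !le_min => /andP[/andP[h1 h2] _] /andP[_ /andP[k2 k3]].
have E : `|expR h - 1 - h| <= e4 * `|h|.
  by have := d1P h h1; rewrite add0r expR0 mul1r.
have Co : `|cos k - 1| <= e4 * `|k|.
  by have := d2P k k2; rewrite add0r cos0 sin0 oppr0 mul0r subr0.
have S : `|sin k - k| <= e4 * `|k|.
  by have := d3P k k3; rewrite add0r cos0 sin0 mul1r subr0.
apply: (le_trans (cabs_le_ReIm _)) => /=.
rewrite !mul0r !subr0 !addr0.
set u := expR h in E *; set c := cos k in Co *; set s := sin k in S *.
have u1 : `|u - 1| <= e4.
  have : `|u - 1| <= `|u - 1 - h| + `|h|.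
    by rewrite -{1}(subrK h (u - 1)) ler_normD.
  by have := normr_ge0 h; nra.
have A : `|u * c - 1 - h| <= 2 * e4 * `|k| + e4 * `|h|.
  have -> : u * c - 1 - h = (u - 1) * (c - 1) + (c - 1) + (u - 1 - h) by ring.
  apply: (le_trans (ler_normD _ _)); apply: lerD => //.
  apply: (le_trans (ler_normD _ _)); rewrite normrM.
  by have := normr_ge0 (c - 1); nra.
have B : `|u * s - k| <= 3 * e4 * `|k|.
  have -> : u * s - k = (u - 1) * (s - k) + (s - k) + (u - 1) * k by ring.
  apply: (le_trans (ler_normD _ _)); rewrite normrM.
  have : `|(u - 1) * (s - k) + (s - k)| <= 2 * e4 * `|k|.
    apply: (le_trans (ler_normD _ _)); rewrite normrM.
    by have := normr_ge0 (s - k); nra.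
  by have := normr_ge0 k; nra.
by have := normr_ge0 k; have := normr_ge0 h; nra.
Qed.

(** The complex exponential of x + iy: vertical segments become arcs centred at 0, and an annulus is
    the image of a rectangle of height 2 * pi. *)
Definition polar x y : C := (expR x)%:C * expi y.

Lemma cabs_polar x y : cabs (polar x y) = expR x.
Proof. by rewrite cabsM cabs_expi mulr1 cabsR ger0_norm// expR_ge0. Qed.

Lemma polarD x y h k : polar (x + h) (y + k) = polar x y * polar h k.
Proof. by rewrite /polar expRD expiD rmorphM/= mulrACA. Qed.

(** Chain rule, with derivative m = c * w0. Half of [e] pays for the expansion of the exponential,
    through [eta]; the other half pays for that of [G], with e / (4 * K) because the increment of
    the argument is at most 2 * K * (|h| + |k|). *)
Lemma cr_diff_polar G x y : derivable G (polar x y) 1 ->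
  cr_diff (fun x y => complex.Re (G (polar x y)))
          (fun x y => complex.Im (G (polar x y))) x y.
Proof.
move=> /derivable_affine[c Gc].
pose w0 := polar x y; pose m := c * w0; pose K := expR x.
exists (complex.Re m), (complex.Im m) => e e0.
have K0 : 0 < K by exact: expR_gt0.
have cK0 : 0 <= cabs c * K by rewrite mulr_ge0 ?cabs_ge0 ?ltW.
have cK1 : 0 < 2 * (cabs c * K + 1) by lra.
pose eta := Num.min 1 (e / (2 * (cabs c * K + 1))).
have eta0 : 0 < eta by rewrite lt_min ltr01 divr_gt0.
have eta1 : eta <= 1 by rewrite ge_min lexx.
have eta2 : cabs c * K * eta <= e / 2.
  have : eta <= e / (2 * (cabs c * K + 1)) by rewrite ge_min lexx orbT.
  by rewrite ler_pdivlMr//; nra.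
have [d1 d10 d1P] := expi_exp_affine eta0.
have [d2 d20 d2P] := Gc (e / (4 * K)) (divr_gt0 e0 (mulr_gt0 (ltr0n _ 4) K0)).
exists (Num.min d1 (d2 / (8 * K))).
  by rewrite lt_min d10 divr_gt0// mulr_gt0.
move=> h k; rewrite !le_min => /andP[h1 h2] /andP[k1 k2].
have K8 : 0 < 8 * K by rewrite mulr_gt0.
rewrite ler_pdivlMr// in h2; rewrite ler_pdivlMr// in k2.
have E := d1P h k h1 k1.
set E0 := (X in cabs X) in E.
have h0 := normr_ge0 h; have k0 := normr_ge0 k.
have wE : polar (x + h) (y + k) = w0 + w0 * (E0 + (h +i* k)).
  by rewrite polarD -/w0 /E0 subrK -/(polar h k) mulrBr mulr1 addrC subrK.
have hk : cabs (h +i* k) <= `|h| + `|k| by exact: cabs_le_ReIm.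
have D : cabs (w0 * (E0 + (h +i* k))) <= 2 * K * (`|h| + `|k|).
  rewrite cabsM cabs_polar -/K -[2 * K]mulrC -mulrA ler_pM2l//.
  by rewrite (le_trans (cabsD _ _))//; nra.
have Dd : cabs (w0 * (E0 + (h +i* k))) < d2.
  by apply: (le_lt_trans D); nra.
have := d2P _ Dd; rewrite -wE => H.
have tot : cabs (G (polar (x + h) (y + k)) - G w0 - m * (h +i* k)) <= e * (`|h| + `|k|).
  have -> : G (polar (x + h) (y + k)) - G w0 - m * (h +i* k) =
     (G (polar (x + h) (y + k)) - G w0 - c * (w0 * (E0 + (h +i* k)))) + m * E0.
    by rewrite /m; ring.
  apply: (le_trans (cabsD _ _)); rewrite [cabs (m * E0)]cabsM /m cabsM cabs_polar -/K.
  have : e / (4 * K) * cabs (w0 * (E0 + (h +i* k))) <= e / 2 * (`|h| + `|k|).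
    rewrite mulrAC ler_pdivrMr ?mulr_gt0//.
    by have := ler_wpM2l (ltW e0) D; lra.
  have : cabs c * K * cabs E0 <= e / 2 * (`|h| + `|k|) by have := cabs_ge0 E0; nra.
  by move: H; lra.
have ReE z1 z2 z3 : complex.Re (z1 - z2 - z3 * (h +i* k)) =
    complex.Re z1 - complex.Re z2 - (complex.Re z3 * h - complex.Im z3 * k).
  by case: z1 z2 z3 => [? ?] [? ?] [? ?].
have ImE z1 z2 z3 : complex.Im (z1 - z2 - z3 * (h +i* k)) =
    complex.Im z1 - complex.Im z2 - (complex.Im z3 * h + complex.Re z3 * k).
  by case: z1 z2 z3 => [? ?] [? ?] [? ?]; rewrite [_ * h + _]addrC.
split.
- by rewrite -ReE; exact: le_trans (normr_Re_le _) tot.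
- by rewrite -ImE; exact: le_trans (normr_Im_le _) tot.
Qed.

End polar_coordinates.

(** * Means over circles *)

Section circle_integral.
Context {R : realType}.
Notation C := (R[i])^o.
Notation mu := (@lebesgue_measure R).
Implicit Types (b : R -> R) (x y r t : R).

Definition circ : set R := `[0, 2 * pi[%classic.

Lemma circE t : circ t <-> 0 <= t < 2 * pi.
Proof. by rewrite /circ /= in_itv. Qed.

Definition cint b : R := \int[mu]_(t in circ) b t.

Lemma measurable_circ : measurable circ.
Proof. exact: measurable_itv. Qed.
Local Hint Resolve measurable_circ : core.

Lemma mu_circ : mu circ = (2 * pi)%:E.
Proof.
by rewrite /circ lebesgue_measure_itv/= lte_fin mulr_gt0 ?pi_gt0// -EFinB subr0.
Qed.

(** Measurability is asked on all of [R], which makes composition easy, but the bound only on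
    [circ], where the integrals are taken. *)
Definition bmeas b := measurable_fun setT b /\ exists M, forall t, circ t -> `|b t| <= M.

Lemma bmeas_integrable b : bmeas b -> mu.-integrable circ (EFin \o b).
Proof.
move=> [mb [M bM]]; apply: measurable_bounded_integrable => //.
- by rewrite /= mu_circ ltry.
- exact: measurable_funTS.
- by exists M; split; [exact: num_real|move=> x Mx t /bM /le_trans; apply; exact: ltW].
Qed.

Lemma bmeas_cst (c : R) : bmeas (cst c).
Proof. by split=> //; exists `|c|. Qed.

Lemma bmeasD b1 b2 : bmeas b1 -> bmeas b2 -> bmeas (fun t => b1 t + b2 t).
Proof.
move=> [m1 [M1 bM1]] [m2 [M2 bM2]]; split; first exact: measurable_funD.
by exists (M1 + M2) => t Tt; rewrite (le_trans (ler_normD _ _))// lerD ?bM1 ?bM2.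
Qed.

Lemma bmeasM b1 b2 : bmeas b1 -> bmeas b2 -> bmeas (fun t => b1 t * b2 t).
Proof.
move=> [m1 [M1 bM1]] [m2 [M2 bM2]]; split; first exact: measurable_funM.
by exists (M1 * M2) => t Tt; rewrite normrM ler_pM ?bM1 ?bM2.
Qed.

Lemma bmeasN b : bmeas b -> bmeas (fun t => - b t).
Proof.
move=> [m1 [M1 bM1]]; split; first exact: measurable_funN.
by exists M1 => t Tt; rewrite normrN bM1.
Qed.

Lemma bmeasB b1 b2 : bmeas b1 -> bmeas b2 -> bmeas (fun t => b1 t - b2 t).
Proof. by move=> m1 m2; apply: bmeasD => //; exact: bmeasN. Qed.

Lemma bmeas_indic (A : set R) : measurable A -> bmeas (\1_A : R -> R).
Proof.
move=> mA; split; first exact: measurable_indic.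
by exists 1 => t _; rewrite indicE; case: (_ \in _); rewrite ?normr1 ?normr0.
Qed.

Lemma cint_cst c : cint (fun=> c) = c * (2 * pi).
Proof. by rewrite /cint Rintegral_cst//= mu_circ. Qed.

Lemma cintD b1 b2 : bmeas b1 -> bmeas b2 ->
  cint (fun t => b1 t + b2 t) = cint b1 + cint b2.
Proof. by move=> m1 m2; apply: RintegralD => //; exact: bmeas_integrable. Qed.

Lemma cintB b1 b2 : bmeas b1 -> bmeas b2 ->
  cint (fun t => b1 t - b2 t) = cint b1 - cint b2.
Proof. by move=> m1 m2; apply: RintegralB => //; exact: bmeas_integrable. Qed.

Lemma cintZ c b : bmeas b -> cint (fun t => c * b t) = c * cint b.
Proof. by move=> m1; apply: RintegralZl => //; exact: bmeas_integrable. Qed.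

Lemma eq_cint b1 b2 : (forall t, circ t -> b1 t = b2 t) -> cint b1 = cint b2.
Proof. by move=> b12; apply: eq_Rintegral => t; rewrite inE => /b12. Qed.

Lemma cint_indic (A : set R) : measurable A -> cint \1_A = fine (mu (A `&` circ)).
Proof. by move=> mA; rewrite /cint /Rintegral integral_indic. Qed.

Lemma norm_cint_le b (M : R) : bmeas b -> (forall t, circ t -> `|b t| <= M) ->
  `|cint b| <= M * (2 * pi).
Proof.
move=> bb bM; rewrite -cint_cst.
apply: (le_trans (le_normr_Rintegral _ _)) => //; first exact: bmeas_integrable.
apply: le_Rintegral => //; last exact: (bmeas_integrable (bmeas_cst M)).
by apply: integrable_norm; exact: bmeas_integrable.
Qed.

Lemma cint_cvg (b_ : nat -> R -> R) b (M : R) (N : set R) :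
  (forall n, measurable_fun setT (b_ n)) -> measurable_fun setT b ->
  (forall n t, circ t -> `|b_ n t| <= M) -> mu.-negligible N ->
  (forall t, circ t -> ~ N t -> b_ n t @[n --> \oo] --> b t) ->
  cint (b_ n) @[n --> \oo] --> cint b.
Proof.
move=> mb_ mb bM N0 bb.
have ib n : mu.-integrable circ (EFin \o b_ n).
  by apply: bmeas_integrable; split=> //; exists M; exact: bM.
have [|||||i _ H] := @dominated_convergence _ _ _ mu circ measurable_circ
  (fun n => EFin \o b_ n) (EFin \o b) (EFin \o cst M).
- by move=> n; apply/measurable_EFinP; apply: measurable_funTS; exact: mb_.
- by apply/measurable_EFinP; exact: measurable_funTS.
- apply: negligibleS N0 => t /= Ht; apply: contrapT => Nt; apply: Ht => Tt.
  by apply/fine_cvgP; split; [exact: nearW|exact: bb].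
- exact: (bmeas_integrable (bmeas_cst M)).
- by apply: aeW => t n Tt /=; rewrite lee_fin; exact: bM.
apply: (@fine_cvg _ _ _ _ (fun n => \int[mu]_(t in circ) (b_ n t)%:E)%E).
by rewrite fineK//; exact: integrable_fin_num.
Qed.

End circle_integral.

Section annulus.
Context {R : realType}.
Notation C := (R[i])^o.
Notation mu := (@lebesgue_measure R).
Implicit Types (z w : C) (x y r t : R) (G : C -> C).

Lemma cvg_Re (T : Type) (F : set_system T) {FF : Filter F} (g : T -> C) (l : C) :
  g x @[x --> F] --> l -> complex.Re (g x) @[x --> F] --> complex.Re l.
Proof.
move=> /cvgC_cabs gl; apply/cvgrPdist_lt => e /gl; apply: filterS => x.
by apply: le_lt_trans; rewrite distrC -ReB normr_Re_le.
Qed.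

Lemma cvg_Im (T : Type) (F : set_system T) {FF : Filter F} (g : T -> C) (l : C) :
  g x @[x --> F] --> l -> complex.Im (g x) @[x --> F] --> complex.Im l.
Proof.
move=> /cvgC_cabs gl; apply/cvgrPdist_lt => e /gl; apply: filterS => x.
by apply: le_lt_trans; rewrite distrC -ImB normr_Im_le.
Qed.

Lemma cvg_complex (T : Type) (F : set_system T) {FF : Filter F} (a b : T -> R) (l m : R) :
  a x @[x --> F] --> l -> b x @[x --> F] --> m ->
  (a x +i* b x : C) @[x --> F] --> (l +i* m : C).
Proof.
move=> /cvgrPdist_lt al /cvgrPdist_lt bm; apply/cvgC_cabs => e e0.
near=> x; apply: (le_lt_trans (cabs_le_ReIm _)) => /=; rewrite (splitr e).
rewrite distrC [X in _ + X]distrC; apply: ltrD; near: x.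
- by apply: al; rewrite divr_gt0.
- by apply: bm; rewrite divr_gt0.
Unshelve. all: by end_near. Qed.

Lemma continuous_expi : continuous (@expi R : R -> C).
Proof.
by move=> t; apply: cvg_complex; [exact: continuous_cos|exact: continuous_sin].
Qed.

Lemma cvg_radius (u : nat -> R) r (t : R) : u n @[n --> \oo] --> r ->
  ((u n)%:C * expi t : C) @[n --> \oo] --> (r%:C * expi t : C).
Proof.
move=> ur; apply: cvgM; last exact: cvg_cst.
by apply: cvg_complex => //; exact: cvg_cst.
Qed.

Lemma cabs_radius r t : cabs (r%:C * expi t) = `|r|.
Proof. by rewrite cabsM cabs_expi mulr1 cabsR. Qed.

Lemma measurable_Re_circle G r : (forall t, derivable G (r%:C * expi t) 1) ->
  measurable_fun setT (fun t => complex.Re (G (r%:C * expi t))).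
Proof.
move=> dG; apply: continuous_measurable_fun => t; apply: cvg_Re.
by apply: derivable_cvg => //; apply: cvgM; [exact: cvg_cst|exact: continuous_expi].
Qed.

(* In the coordinate [log w] the annulus is a rectangle whose horizontal sides
   cancel by periodicity. *)
Lemma annulus_integral G (a b r s : R) : 0 < a ->
  (forall w, a < cabs w < b -> derivable G w 1) ->
  a < r -> r <= s -> s < b ->
  cint (fun t => complex.Re (G (r%:C * expi t))) =
  cint (fun t => complex.Re (G (s%:C * expi t))).
Proof.
move=> a0 dG ar rs sb.
have r0 : 0 < r by exact: lt_trans ar.
have s0 : 0 < s by exact: lt_le_trans rs.
have b0 : 0 < b by exact: lt_trans sb.
have dr (q : R) (t : R) : a < q < b -> derivable G (q%:C * expi t) 1.
  by move=> /andP[aq qb]; apply: dG; rewrite cabs_radius ger0_norm ?aq// ltW// (lt_trans a0).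
have UV x y : ln a < x < ln b ->
    cr_diff (fun x y => complex.Re (G (polar x y)))
            (fun x y => complex.Im (G (polar x y))) x y.
  move=> /andP[ax xb]; apply: cr_diff_polar; apply: dr.
  by rewrite -[a]lnK ?posrE// -[b]lnK ?posrE// !ltr_expR ax.
have E : ln r + (ln s - ln r) = ln s by rewrite addrC subrK.
have h1 : ln a < ln r by rewrite ltr_ln ?posrE.
have h2 : ln r + (ln s - ln r) < ln b by rewrite E ltr_ln ?posrE.
have h3 : 0 <= ln s - ln r by rewrite subr_ge0 ler_ln ?posrE.
have h4 : 0 <= 2 * pi :> R by rewrite mulr_ge0// pi_ge0.
have := rectangle_integral0 0 UV h1 h2 h3 h4.
rewrite /rectangle_integral E add0r.
rewrite {1}/polar {1}/polar !lnK ?posrE//.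
have -> : (fun x => complex.Im (G (polar x (2 * pi)))) = (fun x => complex.Im (G (polar x 0))).
  by apply/funext => x; rewrite /polar -[2 * pi]add0r expiD2pi.
rewrite subrr subr0 => /eqP; rewrite subr_eq0 => /eqP H.
have itg (q : R) : a < q < b ->
   mu.-integrable circ (EFin \o (fun t => complex.Re (G (q%:C * expi t)))).
  move=> qab.
  have cq : {within `[0, 2 * pi], continuous (fun t => complex.Re (G (q%:C * expi t)))}.
    apply: continuous_subspaceT => t; apply: cvg_Re.
    apply: derivable_cvg; first exact: dr.
    by apply: cvgM; [exact: cvg_cst|exact: continuous_expi].
  have := integrable_segment cq; rewrite /circ => itf.
  by apply: integrableS itf => //; apply: subset_itvl; rewrite bnd_simp.
rewrite /cint /circ !Rintegral_itv_bndo_bndc//; apply: itg; apply/andP; split => //.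
- exact: lt_le_trans rs.
- exact: le_lt_trans sb.
Qed.

End annulus.

Section mean_value_property.
Context {R : realType}.
Notation C := (R[i])^o.
Notation mu := (@lebesgue_measure R).
Implicit Types (z w : C) (x y r t : R) (G : C -> C).

Lemma negligible_set1 (x : R) : mu.-negligible [set x].
Proof. by apply/negligibleP => //; exact: lebesgue_measure_set1. Qed.

Lemma negligible_expi r z : r != 0 -> mu.-negligible [set t | circ t /\ r%:C * expi t = z].
Proof.
move=> r0; apply: negligibleS (negligible_set1 (angle (z / r%:C))) => t [/circE tc <-] /=.
by rewrite mulrAC mulfV ?mul1r ?angle_expi// -cabs_eq0 cabsR normr_eq0.
Qed.

Lemma harmonic_itv n : 0 < @harmonic R n <= 1.
Proof. by rewrite /= invr_gt0 ltr0n /= invf_le1 ?ler1n ?ltr0n. Qed.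

(* The circle means of [G] are constant on either side of the circle through
   the exceptional point, and dominated convergence glues the two values. *)
Theorem mean_value G z0 M r : z0 != 0 ->
  (forall w, cabs w < 1 -> w != z0 -> derivable G w 1) ->
  (forall w, cabs w < 1 -> cabs (G w) <= M) ->
  cabs z0 < r < 1 ->
  cint (fun t => complex.Re (G (r%:C * expi t))) = complex.Re (G 0) * (2 * pi).
Proof.
move=> z00 dG GM /andP[z0r r1].
pose p := cabs z0.
have p0 : 0 < p by rewrite lt_neqAle eq_sym cabs_eq0 z00 cabs_ge0.
have p1 : p < 1 by exact: lt_trans r1.
have dGc w : cabs w < 1 -> cabs w != p -> derivable G w 1.
  by move=> w1 wp; apply: dG => //; apply: contraNneq wp => ->.
have bG (s : R) t : 0 < s < 1 -> `|complex.Re (G (s%:C * expi t))| <= M.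
  move=> /andP[s0 s1]; apply: (le_trans (normr_Re_le _)); apply: GM.
  by rewrite cabs_radius gtr0_norm.
have mG (s : R) : 0 < s < 1 -> s != p -> measurable_fun setT (fun t => complex.Re (G (s%:C * expi t))).
  move=> /andP[s0 s1] sp; apply: measurable_Re_circle => t.
  by apply: dGc; rewrite cabs_radius gtr0_norm.
(* The point 0 is regular since z0 is not 0. The circles of radius s / (n + 1) all have the same
   mean, which tends to the value at 0. *)
have inner_circle s : 0 < s < p ->
    cint (fun t => complex.Re (G (s%:C * expi t))) = complex.Re (G 0) * (2 * pi).
  move=> /andP[s0 sp]; pose u n : R := s * harmonic n.
  have us n : 0 < u n <= s.
    by have /andP[h0 h1] := harmonic_itv n; rewrite /u mulr_gt0// ger_pMr.
  have u0 : u n @[n --> \oo] --> (0 : R).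
    by rewrite -(mulr0 s); apply: cvgM; [exact: cvg_cst|exact: cvg_harmonic].
  have ucst n : cint (fun t => complex.Re (G ((u n)%:C * expi t))) =
                cint (fun t => complex.Re (G (s%:C * expi t))).
    have /andP[un0 uns] := us n.
    apply: (@annulus_integral _ _ (u n / 2) p) => //; [by rewrite divr_gt0| |lra].
    move=> w /andP[_ wp]; apply: dGc; first exact: lt_trans p1.
    by rewrite lt_eqF.
  have : cint (fun t => complex.Re (G ((u n)%:C * expi t))) @[n --> \oo] -->
         cint (fun=> complex.Re (G 0)).
    apply: (@cint_cvg _ _ _ M set0) => //.
    - move=> n; have /andP[un0 uns] := us n; apply: mG; first by rewrite un0 /=; lra.
      by rewrite lt_eqF//; lra.
    - by move=> n t _; apply: bG; have /andP[-> uns] := us n => /=; lra.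
    - exact: negligible_set0.
    - move=> t _ _; apply: cvg_Re; apply: derivable_cvg.
        by apply: dGc; rewrite cabs0// lt_eqF.
      by have := cvg_radius (t := t) u0; rewrite mul0r.
  move=> /(cvg_lim (@Rhausdorff R)); under eq_fun do rewrite ucst.
  by rewrite lim_cst// cint_cst.
pose u n : R := p - p / 2 * harmonic n.
pose v n : R := p + (r - p) * harmonic n.
have un n : 0 < u n < p.
  have /andP[h0 h1] := harmonic_itv n; have p20 : 0 < p / 2 by lra.
  by have := mulr_gt0 p20 h0; have := ger_pMr (harmonic n) p20; rewrite h1 /u; lra.
have vn n : p < v n <= r.
  have /andP[h0 h1] := harmonic_itv n; have rp0 : 0 < r - p by rewrite subr_gt0.
  by have := mulr_gt0 rp0 h0; have := ger_pMr (harmonic n) rp0; rewrite h1 /v; lra.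
have up : u n @[n --> \oo] --> p.
  rewrite -[X in _ --> X]subr0 -(mulr0 (p / 2)); apply: cvgB; first exact: cvg_cst.
  by apply: cvgM; [exact: cvg_cst|exact: cvg_harmonic].
have vp : v n @[n --> \oo] --> p.
  rewrite -[X in _ --> X]addr0 -(mulr0 (r - p)); apply: cvgD; first exact: cvg_cst.
  by apply: cvgM; [exact: cvg_cst|exact: cvg_harmonic].
have vcst n : cint (fun t => complex.Re (G ((v n)%:C * expi t))) =
              cint (fun t => complex.Re (G (r%:C * expi t))).
  have /andP[vn0 vnr] := vn n.
  apply: (@annulus_integral _ _ p 1) => //.
  by move=> w /andP[pw w1]; apply: dGc => //; rewrite gt_eqF.
have un1 n : 0 < u n < 1 by have := un n; lra.
have vn1 n : 0 < v n < 1 by have := vn n; lra.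
have mu_ n : bmeas (fun t => complex.Re (G ((u n)%:C * expi t))).
  split; first by apply: mG => //; rewrite lt_eqF//; have := un n; lra.
  by exists M => t _; exact: bG.
have mv_ n : bmeas (fun t => complex.Re (G ((v n)%:C * expi t))).
  split; first by apply: mG => //; rewrite gt_eqF//; have := vn n; lra.
  by exists M => t _; exact: bG.
(* Radii approach p from both sides. The integral of [b n] does not depend on n, while [b n] tends
   to 0 except at the angle of z0. *)
pose b n t := complex.Re (G ((v n)%:C * expi t)) - complex.Re (G ((u n)%:C * expi t)).
have : cint (b n) @[n --> \oo] --> cint (fun=> 0).
  apply: (@cint_cvg _ _ _ (M + M) [set t | circ t /\ p%:C * expi t = z0]) => //.
  - by move=> n; have [] := bmeasB (mv_ n) (mu_ n).
  - by move=> n t _; rewrite (le_trans (ler_normB _ _))// lerD// bG.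
  - by apply: negligible_expi; rewrite gt_eqF.
  - move=> t tc /= tN; have dGt : derivable G (p%:C * expi t) 1.
      apply: dG; first by rewrite cabs_radius gtr0_norm.
      by apply/eqP => E; apply: tN.
    suff : b n t @[n --> \oo] -->
        complex.Re (G (p%:C * expi t)) - complex.Re (G (p%:C * expi t)) by rewrite subrr.
    by apply: cvgB; apply: cvg_Re; apply: (derivable_cvg dGt); exact: cvg_radius.
have bE : (fun n => cint (b n)) = (fun=>
    cint (fun t => complex.Re (G (r%:C * expi t))) - complex.Re (G 0) * (2 * pi)).
  by apply/funext => n; rewrite -(vcst n) -(inner_circle _ (un n)) -cintB.
move=> /(cvg_lim (@Rhausdorff R)); rewrite bE.
by rewrite lim_cst// cint_cst mul0r => /eqP; rewrite subr_eq0 => /eqP.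
Qed.

End mean_value_property.

(** * Poisson's formula for radial limits *)

Section poisson_kernel.
Context {R : realType}.
Notation C := (R[i])^o.
Notation mu := (@lebesgue_measure R).
Implicit Types (z w : C) (x y r t : R) (f G : C -> C).

Definition poisson z t : R := (1 - cabs z ^+ 2) / cabs (expi t - z) ^+ 2.

Lemma cabs_expiB_ge z t : 1 - cabs z <= cabs (expi t - z).
Proof. by have := cabs_ge_sub (expi t) z; rewrite cabs_expi. Qed.

Lemma poisson_ge0 z t : cabs z < 1 -> 0 <= poisson z t.
Proof.
move=> z1; rewrite divr_ge0 ?sqr_ge0// subr_ge0 expr_le1// ?cabs_ge0//; exact: ltW.
Qed.

Lemma poisson_le z t : cabs z < 1 -> poisson z t <= (1 - cabs z) ^- 2.
Proof.
move=> z1; have z0 := cabs_ge0 z; rewrite -[leRHS]mul1r; apply: ler_pM.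
- by rewrite subr_ge0 expr_le1// ltW.
- by rewrite invr_ge0 sqr_ge0.
- by rewrite gerBl sqr_ge0.
- have d0 : 0 < 1 - cabs z by rewrite subr_gt0.
  rewrite lef_pV2 ?posrE ?exprn_gt0//; last exact: lt_le_trans (cabs_expiB_ge _ _).
  by rewrite ler_sqr ?nnegrE ?cabs_ge0 ?cabs_expiB_ge// ltW.
Qed.

Lemma measurable_fun_inv d (T : measurableType d) (g : T -> R) :
  (forall u, 0 <= g u) -> measurable_fun setT g ->
  measurable_fun setT (fun u => (g u)^-1).
Proof.
move=> g0 mg; rewrite (_ : (fun _ => _) = (@powR R ^~ (-1)) \o g).
  by apply: measurableT_comp => //; exact: measurable_powR.
by apply/funext => u /=; rewrite powR_inv1.
Qed.

Lemma poissonE z t : poisson z t = (1 - cabs z ^+ 2) *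
  ((cos t - complex.Re z) ^+ 2 + (sin t - complex.Im z) ^+ 2)^-1.
Proof. by rewrite /poisson (cabs_sqr (_ - _)) ReB ImB. Qed.

Lemma bmeas_poisson z : cabs z < 1 -> bmeas (poisson z).
Proof.
move=> z1; split.
  rewrite (_ : poisson z = fun t => (1 - cabs z ^+ 2) *
    ((cos t - complex.Re z) ^+ 2 + (sin t - complex.Im z) ^+ 2)^-1); last first.
    by apply/funext => t; exact: poissonE.
  apply: measurable_funM => //; apply: measurable_fun_inv.
    by move=> t; rewrite addr_ge0 ?sqr_ge0.
  apply: measurable_funD; apply: measurable_funX; apply: measurable_funB => //;
    apply: continuous_measurable_fun; [exact: continuous_cos|exact: continuous_sin].
by exists ((1 - cabs z) ^- 2) => t _; rewrite ger0_norm ?poisson_le ?poisson_ge0.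
Qed.

Lemma one_minus_conj_ge z w : cabs w <= 1 -> 1 - cabs z <= cabs (1 - cj z * w).
Proof.
move=> w1; have := cabs_ge_sub 1 (cj z * w); rewrite cabs1 cabsM cabsJ.
by have := cabs_ge0 z; nra.
Qed.

Lemma one_minus_conj_neq0 z w : cabs z < 1 -> cabs w <= 1 -> 1 - cj z * w != 0.
Proof.
move=> z1 w1; rewrite -cabs_eq0 gt_eqF//.
by rewrite (lt_le_trans _ (one_minus_conj_ge _ w1))// subr_gt0.
Qed.

(** On the circle |expi t - z| = |1 - q| with q = cj z * expi t, and the kernel is the real part of
    (1 + q) / (1 - q) = 2 / (1 - q) - 1. *)
Lemma poisson_ReV z t : cabs z < 1 ->
  poisson z t = 2 * complex.Re ((1 - cj z * expi t)^-1) - 1.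
Proof.
move=> z1; have t1 : cabs (expi t) <= 1 by rewrite cabs_expi.
have := one_minus_conj_neq0 z1 t1.
rewrite -cabs_eq0 -sqrf_eq0 poissonE !cabs_sqr.
have := cos2Dsin2 t.
move: z {z1} => [a b] /=; move: (cos t) (sin t) => c s cs D0.
have E : (c - a) ^+ 2 + (s - b) ^+ 2 = (1 - (a * c - - b * s)) ^+ 2 + (0 - (a * s + - b * c)) ^+ 2.
  apply/eqP; rewrite -subr_eq0 (_ : _ - _ = (1 - a ^+ 2 - b ^+ 2) * (c ^+ 2 + s ^+ 2 - 1)).
    by rewrite cs subrr mulr0.
  by ring.
rewrite E; move: D0 => /=; set D := (X in X != 0) => D0.
have DE : D = 1 - 2 * (a * c + b * s) + (a ^+ 2 + b ^+ 2).
  apply/eqP; rewrite -subr_eq0 (_ : _ - _ = (a ^+ 2 + b ^+ 2) * (c ^+ 2 + s ^+ 2 - 1)).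
    by rewrite cs subrr mulr0.
  by rewrite /D; ring.
have -> : 1 - (a ^+ 2 + b ^+ 2) = 2 * (1 - (a * c - - b * s)) - D by rewrite DE; ring.
by rewrite -/D; clearbody D; field.
Qed.

(** The mean value property lives on radii below 1. Writing z = p * z' with |z| < p < 1 moves the
    unit circle to radius p without changing cj z * expi t; since G 0 = 1, the mean of 2 * Re G - 1
    is 1. *)
Lemma cint_poisson z : cabs z < 1 -> cint (poisson z) = 2 * pi.
Proof.
move=> z1; pose p := (1 + cabs z) / 2.
have z0 := cabs_ge0 z.
have [p0 p1 zp] : [/\ 0 < p, p < 1 & cabs z < p] by rewrite /p; split; lra.
pose z' : C := p^-1%:C * z.
have z'1 : cabs z' < 1.
  by rewrite /z' cabsM cabsR gtr0_norm ?invr_gt0// mulrC ltr_pdivrMr// mul1r.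
pose G w : C := (1 - cj z' * w)^-1.
have p20 : `|p / 2| = p / 2 by rewrite gtr0_norm// divr_gt0.
have p2 : (p / 2)%:C != 0 :> C by rewrite -cabs_eq0 cabsR p20 gt_eqF// divr_gt0.
have dG w : cabs w < 1 -> derivable G w 1.
  move=> w1; apply: derivableV; first exact: one_minus_conj_neq0 (ltW w1).
  apply: derivableB; first exact: derivable_cst.
  by apply: derivableM; [exact: derivable_cst|exact: derivable_id].
have MV : cint (fun t => complex.Re (G (p%:C * expi t))) = complex.Re (G 0) * (2 * pi).
  (* [G] is regular on the whole disc: p / 2 is just some nonzero point inside the circle of radius
     p, put in the place of the exceptional one. *)
  apply: (@mean_value _ _ (p / 2)%:C (1 - cabs z')^-1) => //.
  - by move=> w w1 _; exact: dG.
  - move=> w w1; rewrite cabsV lef_pV2 ?posrE ?subr_gt0//.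
      exact: one_minus_conj_ge (ltW w1).
    by rewrite (lt_le_trans _ (one_minus_conj_ge _ (ltW w1))) ?subr_gt0.
  - by rewrite cabsR p20 p1 andbT; lra.
have zz' t : cj z' * (p%:C * expi t) = cj z * expi t.
  by rewrite /z' cjZ mulrACA -rmorphM mulVf ?gt_eqF// rmorph1 mul1r.
have G0 : G 0 = 1 by rewrite /G mulr0 subr0 invr1.
have mG : bmeas (fun t => complex.Re (G (p%:C * expi t))).
  split.
    by apply: measurable_Re_circle => t; apply: dG; rewrite cabs_radius gtr0_norm.
  exists (1 - cabs z')^-1 => t _.
  apply: (le_trans (normr_Re_le _)).
  have w1 : cabs (p%:C * expi t) < 1 by rewrite cabs_radius gtr0_norm.
  rewrite cabsV lef_pV2 ?posrE ?subr_gt0//.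
    exact: one_minus_conj_ge (ltW w1).
  by rewrite (lt_le_trans _ (one_minus_conj_ge _ (ltW w1))) ?subr_gt0.
have -> : cint (poisson z) = cint (fun t => 2 * complex.Re (G (p%:C * expi t)) - 1).
  by apply: eq_cint => t _; rewrite poisson_ReV// /G zz'.
rewrite cintB ?cintZ ?cint_cst ?MV ?G0 /=; [lra|by []| |exact: bmeas_cst].
by apply: bmeasM => //; exact: bmeas_cst.
Qed.

End poisson_kernel.

Section poisson_integral.
Context {R : realType}.
Notation C := (R[i])^o.
Notation mu := (@lebesgue_measure R).
Implicit Types (z w : C) (x y r t : R) (f G : C -> C).

Lemma cvg_radial (g : R -> C) (l : C) (u : nat -> R) :
  g r @[r --> (1 : R)^'-] --> l -> (forall n, u n < 1) ->
  u n @[n --> \oo] --> (1 : R) -> g (u n) @[n --> \oo] --> l.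
Proof.
move=> /cvgC_cabs gl u1 /cvgrPdist_lt ul; apply/cvgC_cabs => e /gl[d /= d0 dP].
by near=> n; apply: dP => //=; near: n; exact: ul.
Unshelve. all: by end_near. Qed.

(** Sequence of radii along which radial limits enter dominated convergence. The factor 1/2 keeps
    its first term above [r]. *)
Definition to1 (r : R) (n : nat) : R := 1 - (1 - r) / 2 * harmonic n.

Lemma to1_itv r n : r < 1 -> r < to1 r n < 1.
Proof.
move=> r1; have /andP[h0 h1] := @harmonic_itv R n; have r0 : 0 < (1 - r) / 2 by lra.
by have := mulr_gt0 r0 h0; have := ger_pMr (harmonic n) r0; rewrite h1 /to1; lra.
Qed.

Lemma cvg_to1 r : to1 r n @[n --> \oo] --> (1 : R).
Proof.
rewrite -[X in _ --> X]subr0 -(mulr0 ((1 - r) / 2)); apply: cvgB; first exact: cvg_cst.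
by apply: cvgM; [exact: cvg_cst|exact: cvg_harmonic].
Qed.

(** [r0] leaves room for an exceptional point: the circle means are known only beyond its
    modulus. *)
Lemma boundary_integral G (Gb : R -> C) (N : set R) (M c r0 : R) : 0 <= r0 < 1 ->
  (forall r, r0 < r < 1 -> cint (fun t => complex.Re (G (r%:C * expi t))) = c) ->
  (forall r, r0 < r < 1 -> measurable_fun setT (fun t => complex.Re (G (r%:C * expi t)))) ->
  (forall w, cabs w < 1 -> cabs (G w) <= M) ->
  mu.-negligible N -> measurable_fun setT (fun t => complex.Re (Gb t)) ->
  (forall t, circ t -> ~ N t -> G (r%:C * expi t) @[r --> (1 : R)^'-] --> Gb t) ->
  cint (fun t => complex.Re (Gb t)) = c.
Proof.
move=> /andP[r00 r01] Gc mG GM N0 mGb GGb.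
have u1 n : r0 < to1 r0 n < 1 by exact: to1_itv.
have H : cint (fun t => complex.Re (G ((to1 r0 n)%:C * expi t))) @[n --> \oo] -->
    cint (fun t => complex.Re (Gb t)).
  apply: (@cint_cvg _ _ _ M N) => //.
  - by move=> n; exact: mG.
  - move=> n t _; apply: (le_trans (normr_Re_le _)); apply: GM.
    by rewrite cabs_radius ger0_norm; have := u1 n; lra.
  - move=> t tc tN; apply: cvg_Re.
    apply: (cvg_radial (g := fun r => G (r%:C * expi t))); first exact: GGb.
      by move=> n; case/andP: (u1 n).
    exact: cvg_to1.
rewrite -(cvg_lim _ H)//; under eq_fun do rewrite Gc//.
exact: lim_cst.
Qed.

(* On the unit circle this is the Poisson kernel, and it vanishes at [0]. *)
Definition herglotz z w : C := w / (w - z) + (1 - cj z * w)^-1 - 1.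

Lemma cjV z : cj (z^-1) = (cj z)^-1.
Proof. by case: z => a b; apply: complex_ext; rewrite /= sqrrN// mulNr. Qed.

(** As expi t - z is expi t times the conjugate of 1 - cj z * expi t, the first two terms of
    [herglotz] are conjugate and add up to twice a real part. *)
Lemma herglotz_expi z t : cabs z < 1 -> herglotz z (expi t) = (poisson z t)%:C.
Proof.
move=> z1.
have E1 : expi t * cj (expi t) = 1.
  by apply: complex_ext => /=; [have := cos2Dsin2 t; lra|ring].
have E2 : expi t - z = expi t * cj (1 - cj z * expi t).
  have -> : cj (1 - cj z * expi t) = 1 - z * cj (expi t).
    by apply: complex_ext; case: (z) => a b /=; ring.
  by rewrite mulrBr mulr1 mulrCA E1 mulr1.
rewrite poisson_ReV// /herglotz E2 invfM mulrA mulfV ?expi_neq0// mul1r -cjV.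
move: (_^-1) => V; apply: complex_ext; case: V => a b /=; ring.
Qed.

Lemma derivable_herglotz z w : cabs z < 1 -> w != z -> cabs w <= 1 ->
  derivable (herglotz z) w 1.
Proof.
move=> z1 wz w1.
have d1 : derivable (fun w : C => w - z) w 1.
  by apply: derivableB; [exact: derivable_id|exact: derivable_cst].
have d2 : derivable (fun w : C => (w - z)^-1 : C) w 1.
  by apply: derivableV => //; rewrite subr_eq0.
have d3 : derivable (fun w : C => w / (w - z) : C) w 1.
  by apply: (derivableM _ d2); exact: derivable_id.
have d4 : derivable (fun w : C => 1 - cj z * w : C) w 1.
  apply: derivableB; first exact: derivable_cst.
  by apply: derivableM; [exact: derivable_cst|exact: derivable_id].
have d5 : derivable (fun w : C => (1 - cj z * w)^-1 : C) w 1.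
  by apply: derivableV => //; exact: one_minus_conj_neq0.
have d6 : derivable (fun=> 1 : C) w (1 : C) by exact: derivable_cst.
exact: (derivableB (derivableD d3 d5) d6).
Qed.

(* Mean value property of [(f - f z) * herglotz z], which is bounded near [z],
   followed by the limit at the unit circle. *)
Theorem poisson_formula f (fb : R -> C) (N : set R) (M : R) z :
  (forall w, cabs w < 1 -> derivable f w 1) ->
  (forall w, cabs w < 1 -> cabs (f w) <= M) ->
  mu.-negligible N -> bmeas (fun t => complex.Re (fb t)) ->
  (forall t, circ t -> ~ N t -> f (r%:C * expi t) @[r --> (1 : R)^'-] --> fb t) ->
  cabs z < 1 ->
  cint (fun t => complex.Re (fb t) * poisson z t) = complex.Re (f z) * (2 * pi).
Proof.
move=> df fM N0 mfb ffb z1.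
have M0 : 0 <= M by apply: le_trans (fM z z1); exact: cabs_ge0.
(* The exceptional point of [mean_value] must be nonzero, so z = 0 is apart: there the kernel is 1
   and 1/2 is an arbitrary point in its place. *)
have [->|z0] := eqVneq z 0.
  rewrite (_ : cint _ = cint (fun t => complex.Re (fb t))); last first.
    by apply: eq_cint => t _; rewrite /poisson cabs0 subr0 cabs_expi expr0n expr1n subr0 divr1 mulr1.
  have h1 : cabs ((1 / 2)%:C : C) = 1 / 2 by rewrite cabsR gtr0_norm//; lra.
  apply: (@boundary_integral f _ N M _ (1 / 2)) => //.
  - by apply/andP; split; lra.
  - move=> r rr; apply: (@mean_value _ _ (1 / 2)%:C M) => //; last by rewrite h1.
      by rewrite -cabs_eq0 h1; apply/eqP; lra.
    by move=> w w1 _; exact: df.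
  - move=> r rr; apply: measurable_Re_circle => t; apply: df.
    by rewrite cabs_radius ger0_norm; lra.
  - by case: mfb.
have /derivable_affine[c fc] := df z z1.
have [d d0 dP] := fc _ ltr01.
pose G w := (f w - f z) * herglotz z w.
have dG w : w != z -> cabs w <= 1 -> derivable (herglotz z) w 1.
  exact: derivable_herglotz.
(* The difference quotient of [f] is at most |c| + 1 within distance d of z and at most 2 * M / d
   farther away; the last term bounds the part of [herglotz] without pole in the disc. *)
pose K := (cabs c + 1) + (M + M) / d + (M + M) * ((1 - cabs z)^-1 + 1).
have GK w : cabs w < 1 -> cabs (G w) <= K.
  move=> w1.
  have fMM : cabs (f w - f z) <= M + M.
    by rewrite (le_trans (cabsD _ _))// cabsN lerD// fM.
  have -> : G w = (f w - f z) / (w - z) * w + (f w - f z) * ((1 - cj z * w)^-1 - 1).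
    by rewrite /G /herglotz; ring.
  apply: (le_trans (cabsD _ _)); apply: lerD; last first.
    rewrite cabsM ler_pM ?cabs_ge0// (le_trans (cabsD _ _))// cabsN cabs1 lerD2r cabsV.
    have := one_minus_conj_ge z (ltW w1) => H.
    by rewrite lef_pV2 ?posrE ?subr_gt0// (lt_le_trans _ H)// subr_gt0.
  rewrite cabsM -[leRHS]mulr1 ler_pM ?cabs_ge0//; last exact: ltW.
  have c0 := cabs_ge0 c.
  have Md : 0 <= (M + M) / d by apply: divr_ge0; [lra|exact: ltW].
  have [wzd|wzd] := ltP (cabs (w - z)) d; last first.
    rewrite cabsM cabsV (@le_trans _ _ ((M + M) / d))//; last by lra.
    by rewrite ler_pM ?cabs_ge0 ?invr_ge0 ?cabs_ge0// lef_pV2 ?posrE// (lt_le_trans d0).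
  have [->|wz] := eqVneq w z; first by rewrite subrr mul0r cabs0; lra.
  have wz0 : 0 < cabs (w - z) by rewrite lt_neqAle eq_sym cabs_eq0 subr_eq0 wz cabs_ge0.
  rewrite cabsM cabsV ler_pdivrMr//.
  have := dP _ wzd; rewrite [z + _]addrC subrK mul1r => H.
  have -> : f w - f z = (f w - f z - c * (w - z)) + c * (w - z) by rewrite subrK.
  by rewrite (le_trans (cabsD _ _))// cabsM; nra.
(* The mean is [Re (G 0)], which is 0 because [herglotz z] vanishes at 0. The formula follows since
   the kernel has integral 2 * pi. *)
have : cint (fun t => complex.Re ((fb t - f z) * (poisson z t)%:C)) = 0.
  apply: (@boundary_integral G _ N K _ (cabs z)).
  - by rewrite cabs_ge0 z1.
  - move=> r rz; have -> : 0 = complex.Re (G 0) * (2 * pi) :> R.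
      by rewrite /G /herglotz mul0r mulr0 subr0 invr1 add0r subrr mulr0 /= mul0r.
    apply: (@mean_value _ _ z K) z0 _ GK rz => w w1 wz.
     apply: derivableM; last exact: dG (ltW w1).
    by apply: derivableB; [exact: df|exact: derivable_cst].
  - move=> r /andP[zr r1]; apply: measurable_Re_circle => t.
    have rr : cabs (r%:C * expi t) = r.
      by rewrite cabs_radius ger0_norm// ltW// (le_lt_trans (cabs_ge0 z)).
    apply: derivableM.
      by apply: derivableB; [apply: df; rewrite rr|exact: derivable_cst].
    apply: dG; last by rewrite rr ltW.
    by apply: contraTneq zr => <-; rewrite rr ltxx.
  - exact: GK.
  - exact: N0.
  - rewrite (_ : (fun _ => _) = fun t => (complex.Re (fb t) - complex.Re (f z)) * poisson z t).
      apply: measurable_funM; last by case: (bmeas_poisson z1).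
      by apply: measurable_funB => //; case: mfb.
    by apply/funext => t; rewrite -ReB; case: (fb t - f z) => a b /=; ring.
  - move=> t tc tN; rewrite -herglotz_expi//; apply: cvgM.
      by apply: cvgB; [exact: ffb|exact: cvg_cst].
    apply: (@derivable_cvg _ (herglotz z) (expi t)).
      apply: dG; last by rewrite cabs_expi.
      by apply: contraTneq z1 => <-; rewrite cabs_expi ltxx.
    apply: cvg_at_left_filter; rewrite -[X in _ --> X]mul1r; apply: cvgM; last exact: cvg_cst.
    by apply: cvg_complex; [exact: cvg_id|exact: cvg_cst].
have mP := bmeas_poisson z1.
rewrite (eq_cint (b2 := fun t => complex.Re (fb t) * poisson z t - complex.Re (f z) * poisson z t)); last first.
  by move=> t _; rewrite -mulrBl -ReB; case: (fb t - f z) => a b /=; ring.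
rewrite cintB ?(cintZ _ mP) ?cint_poisson//; last 2 first.
- exact: bmeasM.
- by apply: bmeasM => //; exact: bmeas_cst.
by move=> /eqP; rewrite subr_eq0 => /eqP.
Qed.

End poisson_integral.

(** * Trigonometric polynomials determine measures on the circle *)

Section trigonometric_class.
Context {R : realType}.
Notation C := (R[i])^o.
Implicit Types (b : R -> R).

(* [acos] is a junk value outside of [-1, 1]. *)
Definition acos_clamp (x : R) : R := acos (Num.max (-1) (Num.min 1 x)).

Lemma acos_clampE x : -1 <= x <= 1 -> acos_clamp x = acos x.
Proof. by move=> /andP[x1 x2]; rewrite /acos_clamp min_r// max_r. Qed.

Lemma measurable_acos_clamp : measurable_fun setT acos_clamp.
Proof.
apply: nonincreasing_measurable => //= y x yx.
have itv u : (-1 : R) <= Num.max (-1) (Num.min 1 u) <= 1.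
  by rewrite le_max lexx ge_max ge_min lexx /=; lra.
have acosP u : -1 <= u <= 1 -> acos u \in `[0, pi].
  by move=> ?; rewrite in_itv/= acos_ge0// acos_lepi.
rewrite /acos_clamp leNgt -ltr_cos ?acosP// !acosK ?in_itv//= ?itv// -leNgt.
by rewrite le_max2// le_min2.
Qed.

Lemma measurable_angle d (T : measurableType d) (g : T -> C) :
  measurable_fun setT (fun x => complex.Re (g x)) ->
  measurable_fun setT (fun x => complex.Im (g x)) ->
  (forall x, cabs (g x) = 1) -> measurable_fun setT (fun x => angle (g x)).
Proof.
move=> mRe mIm g1.
rewrite (_ : (fun _ => _) = fun x => if 0 <= complex.Im (g x)
    then acos_clamp (complex.Re (g x)) else 2 * pi - acos_clamp (complex.Re (g x))).
  apply: measurable_fun_ifT.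
  - by apply: measurable_fun_ler.
  - by apply: measurableT_comp => //; exact: measurable_acos_clamp.
  - apply: measurable_funB => //.
    by apply: measurableT_comp => //; exact: measurable_acos_clamp.
apply/funext => x; rewrite /angle !acos_clampE//.
by have := normr_Re_le (g x); rewrite g1 ler_norml.
Qed.

(** The phase [a] makes sines into instances of the only generator, and product-to-sum formulas then
    keep products in the class. *)
Inductive trig : (R -> R) -> Prop :=
| trig_cos (k : nat) (a : R) : trig (fun t => cos (k%:R * t + a))
| trigD b1 b2 : trig b1 -> trig b2 -> trig (fun t => b1 t + b2 t)
| trigZ c b : trig b -> trig (fun t => c * b t).

Lemma trig1 : trig (fun=> 1).
Proof.
rewrite (_ : (fun=> 1) = fun t => cos (0%:R * t + 0)); first exact: trig_cos.
by apply/funext => t; rewrite mul0r addr0 cos0.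
Qed.

Lemma trig_sin : trig (@sin R).
Proof.
rewrite (_ : sin = fun t => cos (1%:R * t + - (pi / 2))); first exact: trig_cos.
by apply/funext => t; rewrite mul1r cosBpihalf.
Qed.

Lemma trig_cos1 : trig (@cos R).
Proof.
rewrite (_ : cos = fun t => cos (1%:R * t + 0)); first exact: trig_cos.
by apply/funext => t; rewrite mul1r addr0.
Qed.

Lemma trig_affine b c d : trig b -> trig (fun t => c * b t + d).
Proof.
move=> tb; apply: (trigD (trigZ c tb) (b2 := fun=> d)).
rewrite (_ : (fun=> d) = fun t => d * (fun=> 1) t); first exact/trigZ/trig1.
by apply/funext => t; rewrite mulr1.
Qed.

Lemma trig_bounded b : trig b -> exists M, forall t, `|b t| <= M.
Proof.
elim=> [k a|b1 b2 _ [M1 H1] _ [M2 H2]|c b1 _ [M1 H1]].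
- by exists 1 => t; exact: cos_max.
- by exists (M1 + M2) => t; rewrite (le_trans (ler_normD _ _))// lerD.
- by exists (`|c| * M1) => t; rewrite normrM ler_wpM2l.
Qed.

Lemma trigM b1 b2 : trig b1 -> trig b2 -> trig (fun t => b1 t * b2 t).
Proof.
move=> t1 t2; elim: t1 => {b1} [k a|b b' _ IH _ IH'|c b _ IH].
- elim: t2 => {b2} [l d|b b' _ IH _ IH'|c b _ IH].
  (* Frequencies of generators are natural numbers; a negative difference is turned around by parity
     of the cosine. *)
  + have diff (m n : nat) (e : R) : trig (fun t => cos ((m%:R - n%:R) * t + e)).
      have [mn|/ltnW nm] := leqP m n.
        rewrite (_ : (fun _ => _) = fun t => cos ((n - m)%:R * t + - e)); first exact: trig_cos.
        by apply/funext => t; rewrite natrB// -cosN; congr cos; ring.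
      rewrite -natrB//; exact: trig_cos.
    rewrite (_ : (fun _ => _) = fun t => 2^-1 * cos ((k + l)%:R * t + (a + d)) +
                                       2^-1 * cos ((k%:R - l%:R) * t + (a - d))).
      by apply: trigD; apply: trigZ; [exact: trig_cos|exact: diff].
    apply/funext => t.
    rewrite (_ : (k + l)%:R * t + (a + d) = (k%:R * t + a) + (l%:R * t + d)); last by rewrite natrD; ring.
    rewrite (_ : (k%:R - l%:R) * t + (a - d) = (k%:R * t + a) - (l%:R * t + d)); last by ring.
    by rewrite (cosD (_ * _ + _) (_ * _ + _)) (cosB (_ * _ + _)); lra.
  + by under eq_fun do rewrite mulrDr; exact: trigD.
  + by under eq_fun do rewrite mulrCA; exact: trigZ.
- by under eq_fun do rewrite mulrDl; exact: trigD.
- by under eq_fun do rewrite -mulrA; exact: trigZ.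
Qed.

(* The Newton-Schulz iteration, whose limit on [-1, 1] is the sign. *)
Fixpoint sgn_iter (n : nat) (x : R) : R :=
  if n is m.+1 then sgn_iter m x * (3 - sgn_iter m x ^+ 2) / 2 else x.

Lemma sgn_iterN n x : sgn_iter n (- x) = - sgn_iter n x.
Proof. by elim: n => //= n ->; rewrite sqrrN !mulNr. Qed.

Lemma sgn_iter0 n : sgn_iter n 0 = 0.
Proof. by elim: n => //= n ->; rewrite !mul0r. Qed.

Lemma sgn_iter_itv n x : 0 < x <= 1 -> x <= sgn_iter n x <= 1.
Proof.
move=> /andP[x0 x1]; elim: n => [|n /andP[/= s0 s1]]; first by rewrite /= lexx.
set s := sgn_iter n x in s0 s1 *; have sp : 0 <= s by lra.
have D : s * (3 - s ^+ 2) / 2 - s = s * (1 - s) * (1 + s) / 2 by field.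
have D' : 1 - s * (3 - s ^+ 2) / 2 = (1 - s) ^+ 2 * (2 + s) / 2 by field.
have : 0 <= s * (1 - s) * (1 + s) by rewrite !mulr_ge0//; lra.
have : 0 <= (1 - s) ^+ 2 * (2 + s) by rewrite mulr_ge0 ?sqr_ge0//; lra.
by lra.
Qed.

(** From an iterate s, one step multiplies the error 1 - s by (1 - s) * (2 + s) / 2 = 1 - (s + s^2)
    / 2, which is at most 1 - x / 2 because s >= x. *)
Lemma sgn_iter_dist n x : 0 < x <= 1 -> 1 - sgn_iter n x <= (1 - x / 2) ^+ n.
Proof.
move=> x01; elim: n => [|n IH]; first by rewrite expr0 /=; have := x01; lra.
have := sgn_iter_itv n x01; rewrite /=; set s := sgn_iter n x in IH * => s1.
rewrite [leRHS]exprS; apply: (@le_trans _ _ ((1 - x / 2) * (1 - s))).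
  have -> : 1 - s * (3 - s ^+ 2) / 2 = (1 - s) ^+ 2 * (2 + s) / 2 by field.
  have D : (1 - x / 2) * (1 - s) - (1 - s) ^+ 2 * (2 + s) / 2 =
    (1 - s) * (s * s + (s - x)) / 2 by field.
  have [s0 s2 sx] : [/\ 0 <= 1 - s, 0 <= s & 0 <= s - x] by have := x01; split; lra.
  have : 0 <= (1 - s) * (s * s + (s - x)) by exact: mulr_ge0 s0 (addr_ge0 (mulr_ge0 s2 s2) sx).
  by lra.
by rewrite ler_wpM2l//; have := x01; lra.
Qed.

Lemma sgn_iter_norm n x : `|x| <= 1 -> `|sgn_iter n x| <= 1.
Proof.
have pos y : 0 < y <= 1 -> `|sgn_iter n y| <= 1.
  by move=> y01; have := sgn_iter_itv n y01; rewrite ler_norml; lra.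
rewrite ler_norml => /andP[x1 x2]; have [x0|x0|->] := ltgtP x 0.
- by rewrite -(opprK x) sgn_iterN normrN; apply: pos; lra.
- by apply: pos; rewrite x0.
- by rewrite sgn_iter0 normr0.
Qed.

Lemma cvg_sgn_iter x : `|x| <= 1 -> sgn_iter n x @[n --> \oo] --> Num.sg x.
Proof.
have pos y : 0 < y <= 1 -> sgn_iter n y @[n --> \oo] --> (1 : R).
  move=> y01; apply: (@squeeze_cvgr _ _ _ _ (fun n => 1 - (1 - y / 2) ^+ n) (cst 1)).
  - apply: nearW => n /=; have := sgn_iter_dist n y01; have := sgn_iter_itv n y01; lra.
  - rewrite -[X in _ --> X]subr0; apply: cvgB; first exact: cvg_cst.
    by apply: cvg_expr; rewrite ger0_norm; lra.
  - exact: cvg_cst.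
rewrite ler_norml => /andP[x1 x2]; have [x0|x0|->] := ltgtP x 0.
- rewrite ltr0_sg//; have -> : sgn_iter^~ x = fun n => - sgn_iter n (- x).
    by apply/funext => n; rewrite sgn_iterN opprK.
  by apply: cvgN; apply: pos; lra.
- by rewrite gtr0_sg//; apply: pos; rewrite x0.
- rewrite sgr0; have -> : sgn_iter^~ 0 = fun=> (0 : R); last exact: cvg_cst.
  by apply/funext => n; exact: sgn_iter0.
Qed.

Lemma trig_sgn_iter n b : trig b -> trig (fun t => sgn_iter n (b t)).
Proof.
move=> tb; elim: n => [//|n IH] /=.
rewrite (_ : (fun _ => _) = fun t => sgn_iter n (b t) *
    (- 2^-1 * (sgn_iter n (b t) * sgn_iter n (b t)) + 3 / 2)).
  by apply: trigM => //; apply: trig_affine; exact: trigM.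
by apply/funext => t; field.
Qed.

(** (s + s^2) / 2 sends the signs 1, 0, -1 to 1, 0, 0: the limit is the indicator of the positive
    numbers. *)
Definition pos_iter n x := (sgn_iter n x + sgn_iter n x ^+ 2) / 2.

Lemma pos_iter_norm n x : `|x| <= 1 -> `|pos_iter n x| <= 1.
Proof.
by move=> /(sgn_iter_norm n); rewrite /pos_iter !ler_norml => ?; apply/andP; split; nra.
Qed.

Lemma cvg_pos_iter x : `|x| <= 1 -> pos_iter n x @[n --> \oo] --> ((0 < x)%R%:R : R).
Proof.
move=> /cvg_sgn_iter sx.
have -> : (0 < x)%R%:R = (Num.sg x + Num.sg x ^+ 2) / 2.
  have [x0|x0|->] := ltgtP x 0.
  - by rewrite ltr0_sg// mulr0n; lra.
  - by rewrite gtr0_sg// mulr1n; lra.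
  - by rewrite sgr0 mulr0n; lra.
by apply: cvgM; [apply: cvgD => //; apply: cvgM|exact: cvg_cst].
Qed.

Lemma trig_pos_iter n b : trig b -> trig (fun t => pos_iter n (b t)).
Proof.
move=> /(trig_sgn_iter n) ts.
rewrite (_ : (fun _ => _) = fun t => 2^-1 * (sgn_iter n (b t) + sgn_iter n (b t) * sgn_iter n (b t))).
  by apply: trigZ; apply: trigD => //; exact: trigM.
by apply/funext => t; rewrite /pos_iter mulrC.
Qed.

(** [E] stands for the functions on which two integrals agree: a linear class, closed under bounded
    pointwise limits, that contains the cosines. *)
Variable E : (R -> R) -> Prop.
Hypothesis ED : forall b1 b2, E b1 -> E b2 -> E (fun t => b1 t + b2 t).
Hypothesis EZ : forall c b, E b -> E (fun t => c * b t).
Hypothesis EL : forall (b_ : nat -> R -> R) b (M : R), (forall n, E (b_ n)) ->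
  (forall n t, `|b_ n t| <= M) -> (forall t, b_ n t @[n --> \oo] --> b t) -> E b.
Hypothesis Ecos : forall (k : nat) (a : R), E (fun t => cos (k%:R * t + a)).

Lemma trigE b : trig b -> E b.
Proof. by elim=> *; [exact: Ecos|exact: ED|exact: EZ]. Qed.

(** [E] is not assumed closed under products. Weights are the multipliers that bring all
    trigonometric polynomials into [E], so that indicators can be multiplied in one after the
    other. *)
Definition weight (w : R -> R) := (exists M, forall t, `|w t| <= M) /\
  forall b, trig b -> E (fun t => b t * w t).

Lemma weight1 : weight (fun=> 1).
Proof.
split; first by exists 1 => t; rewrite normr1.
by move=> b tb; under eq_fun do rewrite mulr1; exact: trigE.
Qed.

Lemma weight_pos w b : weight w -> trig b -> (forall t, `|b t| <= 1) ->
  weight (fun t => (0 < b t)%R%:R * w t).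
Proof.
move=> [[M wM] Ew] tb b1; split.
  exists M => t; rewrite normrM; case: (0 < b t)%R; rewrite ?normr1 ?mul1r//.
  by rewrite normr0 mul0r (le_trans _ (wM t)).
move=> c tc; have [K cK] := trig_bounded tc.
apply: (EL (b_ := fun n t => c t * pos_iter n (b t) * w t) (M := K * M)).
- by move=> n; apply: Ew; apply: trigM => //; exact: trig_pos_iter.
- move=> n t; rewrite normrM ler_pM// normrM -[leRHS]mulr1 ler_pM//.
  exact: pos_iter_norm.
- move=> t; rewrite mulrA; apply: cvgM; last exact: cvg_cst.
  by apply: cvgM; [exact: cvg_cst|exact: cvg_pos_iter].
Qed.

Lemma E_cos_borel w (A : set R) : weight w -> measurable A ->
  E (fun t => \1_A (cos t) * w t).
Proof.
move=> gw; have [[M wM] Ew] := gw.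
have M0 : 0 <= M by rewrite (le_trans _ (wM 0)).
have indic1 (B : set R) x : `|\1_B x : R| <= 1.
  by rewrite indicE; case: (_ \in _); rewrite ?normr1 ?normr0.
pose H := [set A : set R | E (fun t => \1_A (cos t) * w t)].
rewrite (_ : measurable A = (@RGenOInfty.G R).-sigma.-measurable A); last first.
  by rewrite -RGenOInfty.measurableE.
move: A; apply: (@lambda_system_subset _ _ _ setT H) => //.
(* Open right rays form a pi-system that generates the Borel sets. *)
- move=> _ _ [x ->] [y ->]; exists (Num.max x y).
  by apply/seteqP; split => u /=; rewrite !in_itv/= !andbT gt_max => /andP.
- split => //.
  + rewrite /H /=; under eq_fun do rewrite indicT.
    by apply: Ew; exact: trig1.
  + move=> B D DB HB HD; rewrite /H /=.
    rewrite (_ : (fun _ => _) = fun t => \1_B (cos t) * w t + -1 * (\1_D (cos t) * w t)).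
      by apply: ED => //; exact: EZ.
    apply/funext => t; rewrite !indicE in_setD.
    have [xD|xD] := boolP (cos t \in D); last by rewrite andbT mul0r mulr0 addr0.
    by rewrite (mem_set (DB _ (set_mem xD))) /=; ring.
  + move=> F ndF HF; rewrite /H /=.
    apply: (EL (b_ := fun n t => \1_(F n) (cos t) * w t) (M := M)) => //.
      by move=> n t; rewrite normrM -[leRHS]mul1r ler_pM.
    move=> t; apply: cvgM; last exact: cvg_cst.
    rewrite [X in _ --> X]indicE; have [/set_mem[n _ Fn]|nF] := boolP (cos t \in _).
      apply: cvg_near_cst; exists n => // m /= nm; rewrite indicE mem_set//.
      by have /subsetPset := ndF _ _ nm; exact.
    rewrite (_ : (fun _ => _) = fun=> 0); first exact: cvg_cst.
    apply/funext => n; rewrite indicE memNset// => Fn.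
    by move/negP : nF; apply; rewrite inE; exists n.
- move=> _ [c ->]; rewrite /H /=.
  have c0 : 0 < 1 + `|c| by have := normr_ge0 c; lra.
  (* Positive exactly where cos t > c, and scaled into [-1, 1], where [pos_iter] converges. *)
  pose b t := (1 + `|c|)^-1 * cos t + (1 + `|c|)^-1 * - c.
  have tb : trig b by exact/trig_affine/trig_cos1.
  have b1 t : `|b t| <= 1.
    rewrite /b -mulrDr normrM gtr0_norm ?invr_gt0// mulrC ler_pdivrMr// mul1r.
    by rewrite (le_trans (ler_normB _ _))// lerD2r cos_max.
  have [_] := weight_pos gw tb b1.
  move=> /(_ _ trig1); congr E; apply/funext => t; rewrite mul1r indicE; congr (_ * _).
  rewrite /b -mulrDr pmulr_rgt0 ?invr_gt0// subr_gt0; congr ((nat_of_bool _)%:R).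
  by apply/idP/idP => [h|/set_mem]; [apply/mem_set|]; rewrite /= in_itv/= andbT.
Qed.

(* [cos t] determines [t] up to the sign of [sin t]. *)
Theorem E_borel (A : set R) : measurable A -> E (fun t => \1_A (angle (expi t))).
Proof.
move=> mA.
pose w := fun t : R => (0 < - sin t)%R%:R * 1 : R.
have gw : weight w.
  apply: (weight_pos (b := fun t => - sin t) weight1).
    by rewrite (_ : (fun _ => _) = fun t => -1 * sin t);
      [exact/trigZ/trig_sin|apply/funext => t; rewrite mulN1r].
  by move=> t; rewrite normrN sin_max.
pose f := acos_clamp; have mf := measurable_acos_clamp.
pose A1 := f @^-1` A.
pose A2 := (fun x : R => 2 * pi - f x) @^-1` A.
have mA1 : measurable A1 by rewrite /A1 -[X in measurable X]setTI; exact: mf.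
have mA2 : measurable A2.
  rewrite /A2 -[X in measurable X]setTI.
  have : measurable_fun setT (fun x : R => 2 * pi - f x) by exact: measurable_funB.
  exact.
(* [w] is the indicator of sin t < 0, and the sum is \1_A1 * (1 - w) + \1_A2 * w: one branch of
   [angle] on each half of the circle. *)
rewrite (_ : (fun _ => _) = fun t => \1_A1 (cos t) * 1 + (-1 * (\1_A1 (cos t) * w t) + \1_A2 (cos t) * w t)).
  apply: ED; first exact: E_cos_borel weight1 mA1.
  by apply: ED; [apply: EZ|]; exact: E_cos_borel.
apply/funext => t.
have fcos : f (cos t) = acos (cos t).
  by apply: acos_clampE; rewrite cos_geN1 cos_le1.
have memA (B : set R) (g : R -> R) x : (x \in g @^-1` B) = (g x \in B).
  by apply/idP/idP => /set_mem H; apply/mem_set.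
rewrite !indicE /w !mulr1 oppr_gt0 /A1 /A2 (memA _ f) (memA _ (fun x => 2 * pi - f x)) fcos /angle /= leNgt.
by case: (sin t < 0) => /=; rewrite ?mulr1n ?mulr0n; ring.
Qed.

End trigonometric_class.

(** * Inner functions transport Poisson kernels *)

Section boundary_transfer.
Context {R : realType}.
Notation C := (R[i])^o.
Notation mu := (@lebesgue_measure R).
Implicit Types (z w : C) (t : R).

Lemma measurable_cosT : measurable_fun setT (@cos R).
Proof. by apply: continuous_measurable_fun; exact: continuous_cos. Qed.

Lemma measurable_sinT : measurable_fun setT (@sin R).
Proof. by apply: continuous_measurable_fun; exact: continuous_sin. Qed.

Lemma measurable_cos_affine (T : R -> R) (c a : R) : measurable_fun setT T ->
  measurable_fun setT (fun t => cos (c * T t + a)).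
Proof.
move=> mT; apply: measurableT_comp; first exact: measurable_cosT.
by apply: measurable_funD => //; exact: measurable_funM.
Qed.

(** The general form serves twice: a boundary map against the identity of angles, with two Poisson
    kernels, and the identity against itself, with an indicator and a constant as densities. *)
Lemma eq_cint_borel (T1 T2 p1 p2 : R -> R) :
  measurable_fun setT T1 -> measurable_fun setT T2 ->
  (forall t, circ t -> circ (T1 t)) -> (forall t, circ t -> circ (T2 t)) ->
  bmeas p1 -> bmeas p2 ->
  (forall (k : nat) a, cint (fun t => cos (k%:R * T1 t + a) * p1 t) =
                       cint (fun t => cos (k%:R * T2 t + a) * p2 t)) ->
  forall A, measurable A ->
  cint (fun t => \1_A (T1 t) * p1 t) = cint (fun t => \1_A (T2 t) * p2 t).
Proof.
move=> mT1 mT2 cT1 cT2 bp1 bp2 ecos A mA.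
pose bdd (b : R -> R) := measurable_fun setT b /\ exists M, forall t, `|b t| <= M.
pose E b := bdd b /\ cint (fun t => b (T1 t) * p1 t) = cint (fun t => b (T2 t) * p2 t).
have bTp b (T p : R -> R) : measurable_fun setT T -> bmeas p -> bdd b -> bmeas (fun t => b (T t) * p t).
  move=> mT bp [mb [M bM]]; apply: bmeasM => //; split; last by exists M.
  exact: measurableT_comp.
have : E (fun t => \1_A (angle (expi t))).
  apply: E_borel => //.
  - move=> b1 b2 [[m1 [M1 bM1]] e1] [[m2 [M2 bM2]] e2]; split.
      split; first exact: measurable_funD.
      by exists (M1 + M2) => t; rewrite (le_trans (ler_normD _ _))// lerD.
    under eq_cint do rewrite mulrDl; under [in RHS]eq_cint do rewrite mulrDl.
    rewrite !cintD ?e1 ?e2//; apply: bTp => //; split => //; first [by exists M1|by exists M2].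
  - move=> c b [[m1 [M1 bM1]] e1]; split.
      split; first exact: measurable_funM.
      by exists (`|c| * M1) => t; rewrite normrM ler_wpM2l.
    under eq_cint do rewrite -mulrA; under [in RHS]eq_cint do rewrite -mulrA.
    by rewrite !cintZ ?e1//; apply: bTp => //; split=> //; exists M1.
  - move=> b_ b M Eb bM bb.
    have mb : measurable_fun setT b.
      apply: (@measurable_fun_cvg _ _ _ setT b_ b) => [n|t _]; last exact: bb.
      by case: (Eb n) => -[].
    have bbM t : `|b t| <= M.
      rewrite -(cvg_lim _ (cvg_norm (bb t)))//; apply: limr_le; last exact: nearW.
      by apply: is_cvg_norm; apply/cvg_ex; exists (b t); exact: bb.
    split; first by split => //; exists M.
    have limT T p : measurable_fun setT T -> bmeas p ->
        cint (fun t => b_ n (T t) * p t) @[n --> \oo] --> cint (fun t => b (T t) * p t).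
      move=> mT bp; have [mp [K pK]] := bp.
      apply: (@cint_cvg _ _ _ (M * K) set0).
      + by move=> n; apply: measurable_funM => //; apply: measurableT_comp => //; case: (Eb n) => -[].
      + by apply: measurable_funM => //; exact: measurableT_comp.
      + by move=> n t tc; rewrite normrM ler_pM// pK.
      + exact: negligible_set0.
      + by move=> t _ _; apply: cvgM; [exact: bb|exact: cvg_cst].
    have L1 := limT T1 p1 mT1 bp1; have L2 := limT T2 p2 mT2 bp2.
    rewrite (_ : (fun n => cint _) = fun n => cint (fun t => b_ n (T1 t) * p1 t)) in L2.
      exact: (cvg_unique (@Rhausdorff R) L1 L2).
    by apply/funext => n; case: (Eb n).
  - move=> k a; split=> //; split; last by exists 1 => t; exact: cos_max.
    apply: measurable_cos_affine; exact: measurable_id.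
move=> [_ EA].
rewrite [LHS](_ : _ = cint (fun t => \1_A (angle (expi (T1 t))) * p1 t)).
  rewrite EA; apply: eq_cint => t tc; rewrite angle_expi//; exact/circE/cT2.
by apply: eq_cint => t tc; rewrite angle_expi//; exact/circE/cT1.
Qed.

(** A version of the radial boundary map on angles that is total, measurable and has values in
    [circ] everywhere; only the convergence is almost everywhere, so that such maps can be iterated
    freely. *)
Record boundary_map (f : C -> C) (T : R -> R) (N : set R) : Prop := BoundaryMap {
  boundary_map_measurable : measurable_fun setT T;
  boundary_map_circ : forall t, circ (T t);
  boundary_map_null : mu.-negligible N;
  boundary_map_cvg : forall t, circ t -> ~ N t ->
    f (r%:C * expi t) @[r --> (1 : R)^'-] --> (expi (T t) : C) }.

Lemma derivable_exp (f : C -> C) n w : derivable f w 1 -> derivable (fun w : C => f w ^+ n : C) w 1.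
Proof.
move=> df; elim: n => [|n IH].
  by under eq_fun do rewrite expr0; exact: derivable_cst.
by under eq_fun do rewrite exprS; exact: (derivableM df IH).
Qed.

Lemma cvg_exp (S : Type) (F : set_system S) {FF : Filter F} (g : S -> C) (l : C) n :
  g x @[x --> F] --> l -> (g x ^+ n : C) @[x --> F] --> (l ^+ n : C).
Proof.
move=> gl; elim: n => [|n IH]; first by under eq_fun do rewrite expr0; exact: cvg_cst.
by under eq_fun do rewrite exprS; rewrite exprS; exact: (cvgM gl IH).
Qed.

Lemma Re_expi_exp (a s : R) (k : nat) :
  complex.Re (expi a * expi s ^+ k : C) = cos (k%:R * s + a).
Proof. by rewrite expiX -expiD /= addrC mulr_natl. Qed.

(** The factor [expi a] shifts the phase, so that real parts alone record the full complex
    moment. *)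
Lemma poisson_formula_cos (f : C -> C) T N (k : nat) a z :
  (forall w, cabs w < 1 -> derivable f w 1) ->
  (forall w, cabs w < 1 -> cabs (f w) < 1) -> boundary_map f T N -> cabs z < 1 ->
  cint (fun t => cos (k%:R * T t + a) * poisson z t) =
  complex.Re (expi a * f z ^+ k : C) * (2 * pi).
Proof.
move=> df f1 [mT cT N0 fT] z1.
rewrite -(@poisson_formula _ (fun w => expi a * f w ^+ k)
  (fun t => expi a * expi (T t) ^+ k) N 1 z _ _ N0 _ _ z1).
- by under [in RHS]eq_cint do rewrite Re_expi_exp.
- move=> w w1; apply: derivableM; first exact: derivable_cst.
  by apply: derivable_exp; exact: df.
- move=> w w1; rewrite cabsM cabs_expi mul1r cabsX exprn_ile1// ?cabs_ge0//.
  exact/ltW/f1.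
- under eq_fun do rewrite Re_expi_exp; split; last by exists 1 => t _; exact: cos_max.
  exact: measurable_cos_affine.
- move=> t tc tN; apply: cvgM; first exact: cvg_cst.
  by apply: cvg_exp; exact: fT.
Qed.

Lemma boundary_map_id : boundary_map id (fun t => angle (expi t)) set0.
Proof.
split.
- apply: measurable_angle => /=; last exact: cabs_expi.
    exact: measurable_cosT.
  exact: measurable_sinT.
- by move=> t; apply/circE/angle_itv/cabs_expi.
- exact: negligible_set0.
- move=> t tc _; rewrite expi_angle ?cabs_expi// -[X in _ --> X]mul1r.
  apply: cvg_at_left_filter; apply: cvgM; last exact: cvg_cst.
  by apply: cvg_complex; [exact: cvg_id|exact: cvg_cst].
Qed.

(** The identity has a boundary map too, and its moments at the point f z are those of [f] at z:
    both are given by f z ^+ k. *)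
Theorem poisson_transfer (f : C -> C) T N z A :
  (forall w, cabs w < 1 -> derivable f w 1) ->
  (forall w, cabs w < 1 -> cabs (f w) < 1) -> boundary_map f T N -> cabs z < 1 ->
  measurable A ->
  cint (fun t => \1_A (T t) * poisson z t) = cint (fun t => \1_A t * poisson (f z) t).
Proof.
move=> df f1 fT z1 mA.
rewrite [RHS](_ : _ = cint (fun t => \1_A (angle (expi t)) * poisson (f z) t)); last first.
  by apply: eq_cint => t tc; rewrite angle_expi//; exact/circE.
have bid := boundary_map_id.
have did w : cabs w < 1 -> derivable (id : C -> C) w 1 by move=> _; exact: derivable_id.
apply: (eq_cint_borel (T2 := fun t => angle (expi t))) => //.
- by case: fT.
- by case: bid.
- by move=> t _; case: fT.
- by move=> t _; case: bid.
- exact: bmeas_poisson.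
- exact/bmeas_poisson/f1.
- move=> k a; rewrite (poisson_formula_cos k a df f1 fT z1).
  by rewrite (poisson_formula_cos k a did _ bid (f1 _ z1)).
Qed.

(** Measurability comes from a sequence of radii: the radial limit is a pointwise limit of
    continuous functions, masked outside a measurable set where it exists and has modulus 1. The
    value 1 elsewhere keeps the modulus equal to 1, as [angle] requires. *)
Lemma inner_boundary_map (f : C -> C) : inner f -> exists T N,
  boundary_map f T N /\
  forall t, circ t -> ~ N t -> radial_ext f (expi t) = expi (T t).
Proof.
move=> [df f1 [N [mN N0 HN]]].
have df' w : cabs w < 1 -> derivable f w 1 by move=> /unit_discE; exact: df.
have f1' w : cabs w < 1 -> cabs (f w) < 1 by move=> /unit_discE /f1 /unit_discE.
pose G := circ `\` N.
have mG : measurable G by apply: measurableD => //; exact: measurable_circ.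
have GP t : G t -> f (r%:C * expi t) @[r --> (1 : R)^'-] --> radial_ext f (expi t) /\
    cabs (radial_ext f (expi t)) = 1.
  move=> [tc tN]; apply: contrapT => H; apply: tN; apply: HN; split; first exact/circE.
  by move=> [cf /unit_circleE f1t]; apply: H.
pose g t : C := if t \in G then radial_ext f (expi t) else 1.
have g1 t : cabs (g t) = 1.
  by rewrite /g; case: ifPn => [/set_mem/GP[]//|_]; exact: cabs1.
pose h n t : C := if t \in G then f ((to1 0 n)%:C * expi t) else 1.
have hg t : h n t @[n --> \oo] --> g t.
  rewrite /h /g; case: ifPn => [/set_mem/GP[H _]|_]; last exact: cvg_cst.
  apply: (cvg_radial (g := fun r => f (r%:C * expi t))) => //; last exact: cvg_to1.
  by move=> n; have /andP[] := to1_itv n (@ltr01 R).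
have mu1 n t : cabs ((to1 0 n)%:C * expi t) < 1.
  have /andP[u0 u1] := to1_itv n (@ltr01 R).
  by rewrite cabs_radius ger0_norm// ltW.
have cont n : continuous (fun t => f ((to1 0 n)%:C * expi t)).
  move=> t; apply: (derivable_cvg (df' _ (mu1 n t))).
  by apply: cvgM; [exact: cvg_cst|exact: continuous_expi].
have mask (k : R -> R) c : measurable_fun setT k ->
    measurable_fun setT (fun t => if t \in G then k t else c).
  move=> mk; apply: measurable_fun_ifT => //.
  apply: (measurable_fun_bool true).
  by rewrite setTI (_ : _ @^-1` _ = G)//; apply/seteqP; split => t /= H; [exact: set_mem|exact: mem_set].
have mRe : measurable_fun setT (fun t => complex.Re (g t)).
  apply: (@measurable_fun_cvg _ _ _ setT (fun n t => complex.Re (h n t))) => [n|t _].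
    rewrite /h; under eq_fun do rewrite (fun_if (@complex.Re R)).
    apply: mask; apply: continuous_measurable_fun => t.
    by apply: cvg_Re; exact: cont.
  by apply: cvg_Re; exact: hg.
have mIm : measurable_fun setT (fun t => complex.Im (g t)).
  apply: (@measurable_fun_cvg _ _ _ setT (fun n t => complex.Im (h n t))) => [n|t _].
    rewrite /h; under eq_fun do rewrite (fun_if (@complex.Im R)).
    apply: mask; apply: continuous_measurable_fun => t.
    by apply: cvg_Im; exact: cont.
  by apply: cvg_Im; exact: hg.
have gE t : G t -> expi (angle (g t)) = radial_ext f (expi t).
  by move=> Gt; rewrite (expi_angle (g1 t)) /g (mem_set Gt).
exists (fun t => angle (g t)), N; split; last by move=> t tc tN; rewrite gE.
split.
- exact: measurable_angle.
- by move=> t; apply/circE/angle_itv.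
- by exists N; split.
- move=> t tc tN; have Gt : G t by split.
  by rewrite (gE t Gt); have [H _] := GP t Gt; exact: H.
Qed.

End boundary_transfer.

(** * Fourier coefficients of a set with constant Poisson integrals *)

Section poisson_fourier.
Context {R : realType}.
Notation C := (R[i])^o.
Notation mu := (@lebesgue_measure R).
Implicit Types (z w : C) (t s : R).

(** Prepares Tonelli's theorem: the bound makes the inner integrals finite, hence [fine] harmless,
    and indicators replace the domain. *)
Lemma cint_cintE (k : R -> R -> R) (M : R) :
  measurable_fun setT (fun x : R * R => k x.1 x.2) ->
  (forall t s, circ t -> circ s -> `|k t s| <= M) ->
  cint (fun t => cint (k t)) =
  fine (\int[mu]_t \int[mu]_s ((k t s * \1_circ t * \1_circ s)%:E))%E.
Proof.
move=> mk kM; rewrite /cint {1}/Rintegral integral_mkcond; congr fine.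
apply: eq_integral => t _; rewrite patchE; case: ifPn => [/set_mem tc|tc]; last first.
  rewrite -[LHS](@integral0 _ _ _ mu setT); apply: eq_integral => s _.
  by rewrite indicE (negbTE tc) mulr0 mul0r.
have bk : bmeas (k t).
  split; last by exists M => s sc; exact: kM.
  by apply: (measurableT_comp (f := fun x : R * R => k x.1 x.2) (g := pair t)).
rewrite /Rintegral fineK; last first.
  by apply: integrable_fin_num => //; [exact: measurable_circ|exact: bmeas_integrable].
rewrite integral_mkcond; apply: eq_integral => s _.
rewrite patchE !indicE (mem_set tc) mulr1; case: ifPn => _; first by rewrite mulr1.
by rewrite mulr0.
Qed.

Lemma cint_swap (k : R -> R -> R) (M : R) :
  measurable_fun setT (fun x : R * R => k x.1 x.2) ->
  (forall t s, 0 <= k t s) ->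
  (forall t s, circ t -> circ s -> k t s <= M) ->
  cint (fun t => cint (k t)) = cint (fun s => cint (k ^~ s)).
Proof.
move=> mk k0 kM.
have msw : measurable_fun setT (fun x : R * R => k x.2 x.1).
  apply: (measurableT_comp (f := fun x : R * R => k x.1 x.2) (g := fun x => (x.2, x.1))) => //.
  by apply: measurable_fun_pair.
have kM' t s : circ t -> circ s -> `|k t s| <= M by move=> tc sc; rewrite ger0_norm ?kM.
rewrite (cint_cintE mk kM') (cint_cintE msw (fun t s tc sc => kM' s t sc tc)).
congr fine.
have mi : measurable_fun setT (\1_(@circ R) : R -> R) by apply: measurable_indic; exact: measurable_circ.
have i0 (A : set R) x : 0 <= \1_A x :> R by rewrite indicE ler0n.
rewrite (@fubini_tonelli _ _ _ _ _ mu mu (fun x => (k x.1 x.2 * \1_circ x.1 * \1_circ x.2)%:E))/=.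
- by apply: eq_integral => s _; apply: eq_integral => t _; rewrite mulrAC.
- apply/measurable_EFinP; apply: measurable_funM; first apply: measurable_funM => //.
  + by apply: (measurableT_comp mi).
  + by apply: (measurableT_comp mi).
- by move=> x; rewrite lee_fin !mulr_ge0.
Qed.

(** Both squared distances are 1 + r^2 - 2 * r * cos (s - t). *)
Lemma poisson_sym (r t s : R) :
  poisson (r%:C * expi t) s = poisson (r%:C * expi s) t.
Proof.
rewrite /poisson !cabs_radius; congr (_ / _).
rewrite !cabs_sqr !ReB !ImB /= !mul0r !subr0 !addr0.
have := cos2Dsin2 s; have := cos2Dsin2 t.
move: (cos t) (sin t) (cos s) (sin s) => a b c d H1 H2.
apply/eqP; rewrite -subr_eq0 (_ : _ - _ = (1 - r ^+ 2) * ((c ^+ 2 + d ^+ 2) - (a ^+ 2 + b ^+ 2))).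
  by rewrite H1 H2 subrr mulr0.
by ring.
Qed.

Lemma cos_mean (k : nat) a z : cabs z < 1 ->
  cint (fun s => cos (k%:R * s + a) * poisson z s) = complex.Re (expi a * z ^+ k : C) * (2 * pi).
Proof.
move=> z1.
have did w : cabs w < 1 -> derivable (id : C -> C) w 1 by move=> _; exact: derivable_id.
rewrite -(poisson_formula_cos k a did (fun _ h => h) boundary_map_id z1).
by apply: eq_cint => t tc; rewrite angle_expi//; exact/circE.
Qed.

Lemma Re_expi_radius_exp (r a t : R) (k : nat) :
  complex.Re (expi a * (r%:C * expi t) ^+ k : C) = r ^+ k * cos (k%:R * t + a).
Proof.
have -> : expi a * (r%:C * expi t) ^+ k = (r ^+ k)%:C * (expi a * expi t ^+ k) :> C.
  by rewrite exprMn mulrCA; congr (_ * _); elim: k => [|k IH]; rewrite ?expr0// !exprS IH -rmorphM.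
rewrite -Re_expi_exp; move: (expi a * _) => z.
by case: z => u v /=; ring.
Qed.

(* Averages the hypothesis over the circle of radius 1/2 against a cosine: by
   Fubini and the symmetry of the kernel, the cosine is reproduced up to the
   factor 2^-k. *)
Lemma constant_poisson (B : set R) c : measurable B ->
  (forall z, cabs z < 1 -> cint (fun t => \1_B t * poisson z t) = c) ->
  forall (k : nat) a, cint (fun t => cos (k%:R * t + a) * \1_B t) =
                      cint (fun t => cos (k%:R * t + a) * (c / (2 * pi))).
Proof.
move=> mB Bc k a.
have pi0 : 2 * pi != 0 :> R by rewrite mulf_neq0// gt_eqF ?pi_gt0.
pose r : R := 2^-1.
have r01 : `|r| < 1 by rewrite /r ger0_norm; lra.
have rt1 t : cabs (r%:C * expi t) < 1 by rewrite cabs_radius.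
(* The added 1 makes the integrand nonnegative, as the exchange of integrals requires; its
   contribution is 2 * pi * c on both sides. *)
pose b s := 1 + cos (k%:R * s + a).
have b0 s : 0 <= b s by have := cos_geN1 (k%:R * s + a); rewrite /b; lra.
have b2 s : b s <= 2 by have := cos_le1 (k%:R * s + a); rewrite /b; lra.
have mcos : bmeas (fun s => cos (k%:R * s + a)).
  split; last by exists 1 => s _; exact: cos_max.
  exact: measurable_cos_affine.
pose K t s := \1_B t * b s * poisson (r%:C * expi t) s.
have mK : measurable_fun setT (fun x : R * R => K x.1 x.2).
  have mi : measurable_fun setT (\1_B : R -> R) by exact: measurable_indic.
  have m1 (g : R -> R) : measurable_fun setT g -> measurable_fun setT (fun x : R * R => g x.1).
    by move=> mg; exact: measurableT_comp.
  have m2 (g : R -> R) : measurable_fun setT g -> measurable_fun setT (fun x : R * R => g x.2).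
    by move=> mg; exact: measurableT_comp.
  apply: measurable_funM.
    apply: measurable_funM; first exact: m1.
    by apply: m2; apply: measurable_funD => //; case: mcos.
  rewrite (_ : (fun _ => _) = fun x : R * R => (1 - `|r| ^+ 2) *
    ((cos x.2 - (r * cos x.1 - 0 * sin x.1)) ^+ 2 + (sin x.2 - (r * sin x.1 + 0 * cos x.1)) ^+ 2)^-1); last first.
    by apply/funext => x; rewrite poissonE cabs_radius.
  apply: measurable_funM => //; apply: measurable_fun_inv.
    by move=> x; rewrite addr_ge0 ?sqr_ge0.
  have mc1 := m1 _ (@measurable_cosT R); have ms1 := m1 _ (@measurable_sinT R).
  have mc2 := m2 _ (@measurable_cosT R); have ms2 := m2 _ (@measurable_sinT R).
  apply: measurable_funD; apply: measurable_funX; apply: measurable_funB => //.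
    by apply: measurable_funB; exact: measurable_funM.
  by apply: measurable_funD; exact: measurable_funM.
have P0 t s : 0 <= poisson (r%:C * expi t) s by exact: poisson_ge0.
have i01 t : 0 <= (\1_B t : R) <= 1 by rewrite !indicE; case: (_ \in _); rewrite ?mulr1n ?mulr0n ?ler01 ?lexx ?ler01.
have K0 t s : 0 <= K t s by have /andP[i0 _] := i01 t; exact: mulr_ge0 (mulr_ge0 i0 (b0 s)) (P0 t s).
have KM t s : K t s <= 2 * (1 - `|r|) ^- 2.
  have /andP[i0 i1] := i01 t.
  apply: ler_pM; [exact: mulr_ge0 i0 (b0 s)|exact: P0| |].
    by rewrite -[leRHS]mul1r; apply: ler_pM.
  by have := poisson_le s (rt1 t); rewrite cabs_radius.
have mP z : cabs z < 1 -> bmeas (poisson z) by exact: bmeas_poisson.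
have mB' : bmeas (\1_B : R -> R) by exact: bmeas_indic.
have poisson0 t : poisson (0 : C) t = 1.
  by rewrite /poisson cabs0 subr0 cabs_expi expr0n expr1n subr0 divr1.
have d0 : cabs (0 : C) < 1 by rewrite cabs0.
have cB : cint \1_B = c.
  by rewrite -(Bc 0 d0); apply: eq_cint => t _; rewrite poisson0 mulr1.
have Y : cint (fun s => cos (k%:R * s + a)) = complex.Re (expi a * 0 ^+ k : C) * (2 * pi).
  by rewrite -(cos_mean k a d0); apply: eq_cint => t _; rewrite poisson0 mulr1.
have swap := @cint_swap K (2 * (1 - `|r|) ^- 2) mK K0 (fun t s _ _ => KM t s).
have E1 t : cint (K t) = 2 * pi * \1_B t + 2 * pi * r ^+ k * (cos (k%:R * t + a) * \1_B t).
  have -> : cint (K t) = \1_B t * cint (fun s => poisson (r%:C * expi t) s +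
      cos (k%:R * s + a) * poisson (r%:C * expi t) s).
    rewrite -(cintZ _ (bmeasD (mP _ (rt1 t)) (bmeasM mcos (mP _ (rt1 t))))).
    by apply: eq_cint => s _; rewrite /K /b; ring.
  rewrite (cintD (mP _ (rt1 t)) (bmeasM mcos (mP _ (rt1 t)))).
  by rewrite (cint_poisson (rt1 t)) (cos_mean k a (rt1 t)) Re_expi_radius_exp; ring.
have E2 s : cint (K ^~ s) = c * b s.
  have -> : cint (K ^~ s) = b s * cint (fun t => \1_B t * poisson (r%:C * expi s) t).
    rewrite -(cintZ _ (bmeasM mB' (mP _ (rt1 s)))).
    by apply: eq_cint => t _; rewrite /K poisson_sym; ring.
  by rewrite (Bc _ (rt1 s)); exact: mulrC.
move: swap; rewrite (eq_cint (fun t _ => E1 t)) (eq_cint (fun s _ => E2 s)).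
have mcB := bmeasM mcos mB'.
rewrite (cintD (bmeasM (bmeas_cst (2 * pi)) mB') (bmeasM (bmeas_cst (2 * pi * r ^+ k)) mcB)).
rewrite (cintZ (2 * pi) mB') (cintZ (2 * pi * r ^+ k) mcB) cB (cintZ _ (bmeasD (bmeas_cst 1) mcos)).
rewrite (cintD (bmeas_cst 1) mcos).
rewrite cint_cst mul1r => H.
have {}H : 2 * pi * r ^+ k * cint (fun t => cos (k%:R * t + a) * \1_B t) =
  c * cint (fun s => cos (k%:R * s + a)) by move: H; lra.
have -> : cint (fun t => cos (k%:R * t + a) * (c / (2 * pi))) = c / (2 * pi) * cint (fun s => cos (k%:R * s + a)).
  by rewrite -(cintZ _ mcos); apply: eq_cint => t _; rewrite mulrC.
(* For k = 0 the factor r ^+ k is 1. For k > 0 the cosine has mean zero, so both sides vanish. *)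
have [k0|k0] := posnP k.
  apply: (mulfI pi0); rewrite mulrA [2 * pi * (c / _)]mulrC divfK// -H.
  by rewrite [in r ^+ k]k0 expr0 mulr1.
have Y0 : cint (fun s => cos (k%:R * s + a)) = 0.
  rewrite Y (_ : expi a * 0 ^+ k = 0); first exact: mul0r.
  by rewrite expr0n gtn_eqF// mulr0.
rewrite Y0 mulr0; move: H; rewrite Y0 mulr0 => /eqP.
by rewrite mulf_eq0 mulf_eq0 (negbTE pi0) expf_eq0 invr_eq0 pnatr_eq0 andbF => /eqP.
Qed.

End poisson_fourier.

(** * Zero-one law *)

Section zero_one.
Context {R : realType}.
Notation C := (R[i])^o.
Notation mu := (@lebesgue_measure R).
Implicit Types (z w : C) (t s : R).

Lemma poisson0 t : poisson (0 : C) t = 1.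
Proof. by rewrite /poisson cabs0 subr0 cabs_expi expr0n expr1n subr0 divr1. Qed.

Lemma mu_circ_finite (A : set R) : measurable A -> A `<=` circ -> mu A = (cint \1_A)%:E.
Proof.
move=> mA Ac; rewrite cint_indic//= (setIidl Ac) fineK//.
rewrite ge0_fin_numE//; apply: (@le_lt_trans _ _ (mu circ)); last by rewrite mu_circ ltry.
by apply: le_measure => //; rewrite inE//; exact: measurable_circ.
Qed.

Lemma cint_indic_null (A : set R) : measurable A -> mu A = 0%E -> cint \1_A = 0.
Proof.
move=> mA A0; rewrite cint_indic// (_ : mu _ = 0%E)//.
apply/eqP; rewrite eq_le measure_ge0 andbT -A0.
by apply: le_measure; rewrite ?inE//; apply: measurableI => //; exact: measurable_circ.
Qed.

(** The density \1_B has the same integrals over Borel sets as the constant c / (2 * pi). Testing on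
    [B] itself gives c = c^2 / (2 * pi), so c is 0 or the full length. *)
Lemma poisson_constant_zero_one (B : set R) c : measurable B -> B `<=` circ ->
  (forall z, cabs z < 1 -> cint (fun t => \1_B t * poisson z t) = c) ->
  mu B = 0%E \/ mu (circ `\` B) = 0%E.
Proof.
move=> mB Bcirc Bc.
have pi0 : 2 * pi != 0 :> R by rewrite mulf_neq0// gt_eqF ?pi_gt0.
have bB : bmeas (\1_B : R -> R) by exact: bmeas_indic.
have cB : cint \1_B = c.
  have z1 : cabs (0 : C) < 1 by rewrite cabs0.
  by rewrite -(Bc 0 z1); apply: eq_cint => t _; rewrite poisson0 mulr1.
have H := @eq_cint_borel _ id id \1_B (cst (c / (2 * pi))) (@measurable_id _ _ setT) (@measurable_id _ _ setT)
  (fun t h => h) (fun t h => h) bB (bmeas_cst _) (constant_poisson mB Bc) B mB.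
have : c = c / (2 * pi) * c.
  rewrite -[LHS]cB -{2}cB -(cintZ (c / (2 * pi)) bB).
  have -> : cint (fun t => c / (2 * pi) * \1_B t) = cint (fun t => \1_B t * (c / (2 * pi))).
    by apply: eq_cint => t _; exact: mulrC.
  rewrite -H; apply: eq_cint => t _ /=.
  by rewrite indicE; case: (_ \in _); rewrite ?mulr1n ?mulr0n ?mulr1 ?mulr0.
have [c0|c0] := eqVneq c 0; first by move=> _; left; rewrite mu_circ_finite// cB c0.
move=> E; have c2 : c = 2 * pi.
  apply: (mulfI c0); apply: (mulIf (invr_neq0 pi0)).
  by rewrite mulfK// {3}E mulrAC.
right; rewrite mu_circ_finite//; last first.
  by apply: measurableD => //; exact: measurable_circ.
have -> : cint \1_(circ `\` B) = cint (fun t => 1 - \1_B t).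
  apply: eq_cint => t tc; rewrite !indicE in_setD (mem_set tc) /=.
  by case: (_ \in _); rewrite ?mulr1n ?mulr0n ?subrr ?subr0.
by rewrite (cintB (bmeas_cst 1) bB) cint_cst cB c2 mul1r subrr.
Qed.

(** Since 1 - r <= d <= 1 + r, the numerator of the difference is at most 4 * r, and r <= 1/2 gives
    d^2 >= 1/4: hence 16. *)
Lemma poisson_near1 w t : cabs w <= 1 / 2 -> `|poisson w t - 1| <= 16 * cabs w.
Proof.
move=> w2; have w0 := cabs_ge0 w.
have d1 := cabs_expiB_ge w t.
have d2 : cabs (expi t - w) <= 1 + cabs w.
  by apply: (le_trans (cabsD _ _)); rewrite cabs_expi cabsN.
rewrite /poisson; set d := cabs (expi t - w) in d1 d2 *; set r := cabs w in w0 w2 d1 d2 *.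
have d0 : 1 / 2 <= d by lra.
have dd : 1 / 4 <= d ^+ 2 by nra.
have D0 : 0 < d ^+ 2 by lra.
have -> : (1 - r ^+ 2) / d ^+ 2 - 1 = (1 - r ^+ 2 - d ^+ 2) / d ^+ 2.
  by rewrite [RHS]mulrBl mulfV// gt_eqF.
rewrite normrM normfV (gtr0_norm D0) ler_pdivrMr//.
have : `|1 - r ^+ 2 - d ^+ 2| <= 4 * r.
  by rewrite ler_norml; apply/andP; split; nra.
by nra.
Qed.

(** The interval behind an arc may lie anywhere and may contain multiples of 2 * pi, so its angles
    in [circ] are collected from all translates by these multiples, in both directions. *)
Lemma circle_angles_arc (A : set C) : is_arc A -> measurable (circle_angles A).
Proof.
move=> [a [b [la [lb [_ ->]]]]]; set J := [set` _].
have pi2 : 0 < 2 * pi :> R by rewrite mulr_gt0// pi_gt0.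
pose S (c : R) : set R := (fun t => t + c) @^-1` J.
have mS c : measurable (S c).
  rewrite /S -[X in measurable X]setTI.
  have : measurable_fun setT (fun t : R => t + c) by exact: measurable_funD.
  by apply => //; exact: measurable_itv.
rewrite (_ : circle_angles _ = circ `&` \bigcup_n (S (2 * pi * n%:R) `|` S (- (2 * pi * n%:R)))).
  apply: measurableI; first exact: measurable_circ.
  by apply: bigcup_measurable => n _; exact: measurableU.
apply/seteqP; split => t /=.
  move=> [tc [s Js st]]; split; first exact/circE.
  pose k := Num.floor (s / (2 * pi)).
  have /andP[k1 k2] : k%:~R <= s / (2 * pi) < (k + 1)%:~R by exact: floor_itv.
  rewrite ler_pdivlMr// in k1; rewrite ltr_pdivrMr// intrD mulrDl mul1r in k2.
  have tE : t = s - 2 * pi * k%:~R.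
    apply: expi_inj => //; first by apply/andP; split; lra.
    by rewrite -st -(expiD2piz (s - _) k) subrK.
  have sE : s = t + 2 * pi * k%:~R by rewrite tE subrK.
  move: sE; case: (k) => n sE.
    by exists n => //; left; rewrite /S /= -sE.
  exists n.+1 => //; right; rewrite /S /=.
  by rewrite NegzE intrN mulrN in sE; rewrite -sE.
move=> [/circE tc [n _ [|] St]]; split => //.
  by exists (t + 2 * pi * n%:R) => //; rewrite expiD2pin.
exists (t - 2 * pi * n%:R) => //.
by rewrite -(expiD2pin (t - _) n) subrK.
Qed.

End zero_one.

(** * Orbits of the boundary maps and their tail events *)

Section orbits.
Context {R : realType}.
Notation C := (R[i])^o.
Notation mu := (@lebesgue_measure R).
Implicit Types (z w : C) (t : R).

(** The hyperbolic distance to the fixed point 0 is ln ((1 + r) / (1 - r)) >= ln (1 + r), with r the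
    modulus. The point z = 0 is apart because [contracting] speaks of distinct points. *)
Lemma contracting_to0 (f : nat -> C -> C) z e : (forall n, fwd_comp f n 0 = 0) ->
  (forall n, cabs (fwd_comp f n z) < 1) -> contracting (fwd_comp f) ->
  cabs z < 1 -> 0 < e -> exists n, cabs (fwd_comp f n z) <= e.
Proof.
move=> F0 F1 cF z1 e0; have [->|/eqP z0] := eqVneq z 0.
  by exists 0%N; rewrite F0 cabs0 ltW.
have d1 : unit_disc z by apply/unit_discE.
have d0 : unit_disc (0 : C) by apply/unit_discE; rewrite cabs0.
have L0 : 0 < ln (1 + e) by rewrite ln_gt0//; lra.
have /cvgrPdist_lt/(_ _ L0)[n _ /(_ n (leqnn n))] := cF _ _ d1 d0 z0.
rewrite sub0r normrN /hyp_dist F0 subr0 (_ : _ / _ = fwd_comp f n z); last first.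
  by rewrite rmorph0 mul0r subr0 divr1.
rewrite -/(cabs _); set r := cabs _ => H.
have r0 : 0 <= r by exact: cabs_ge0.
have r1 : 0 < 1 - r by rewrite subr_gt0; exact: F1.
have q : 1 + r <= (1 + r) / (1 - r) by rewrite ler_pdivlMr//; nra.
have : ln ((1 + r) / (1 - r)) < ln (1 + e) by apply: le_lt_trans H; exact: ler_norm.
rewrite ltr_ln ?posrE; [|lra|lra] => H2.
by exists n; rewrite -/r; lra.
Qed.

Variables (f : nat -> C -> C) (T : nat -> R -> R) (N : nat -> set R).
Hypothesis fi : forall n, inner (f n).
Hypothesis f0 : forall n, centred (f n).
Hypothesis fT : forall n, boundary_map (f n) (T n) (N n).
Hypothesis TE : forall n t, circ t -> ~ N n t -> radial_ext (f n) (expi t) = expi (T n t).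

Let df n w : cabs w < 1 -> derivable (f n) w 1.
Proof. by move=> /unit_discE; have [+ _ _] := fi n; exact. Qed.

Let f1 n w : cabs w < 1 -> cabs (f n w) < 1.
Proof. by move=> /unit_discE w1; apply/unit_discE; have [_ + _] := fi n; exact. Qed.

(** Composes the n + 1 maps from T m to T (m + n), in accordance with [fwd_comp], whose index 0
    already applies f 0. The starting time m is what lets tail events be shifted. *)
Fixpoint orb (m n : nat) t : R :=
  if n is n'.+1 then T (m + n) (orb m n' t) else T m t.

Lemma orbS m n t : orb m n.+1 t = orb m.+1 n (T m t).
Proof. by elim: n => [|n IH]; rewrite /= ?addn1// -addSnnS -IH. Qed.

Lemma measurable_orb m n : measurable_fun setT (orb m n).
Proof.
have mT k : measurable_fun setT (T k) by case: (fT k).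
elim: n => [|n IH] /=; first exact: mT.
exact: measurableT_comp.
Qed.

Lemma orb_circ m n t : circ (orb m n t).
Proof. by case: n => [|n] /=; [case: (fT m)|case: (fT (m + n.+1))]. Qed.

(** At the fixed point 0 both kernels are 1, and the transfer says that T m preserves arc length. *)
Lemma transfer_null m (A : set R) : measurable A -> mu A = 0%E ->
  measurable (circ `&` T m @^-1` A) /\ mu (circ `&` T m @^-1` A) = 0%E.
Proof.
move=> mA A0.
have mT : measurable_fun setT (T m) by case: (fT m).
have mTA : measurable (T m @^-1` A) by rewrite -[X in measurable X]setTI; exact: mT.
have mB : measurable (circ `&` T m @^-1` A).
  by apply: measurableI => //; exact: measurable_circ.
split=> //; rewrite mu_circ_finite//; congr (_%:E).
have z1 : cabs (0 : C) < 1 by rewrite cabs0.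
have := poisson_transfer (@df m) (@f1 m) (fT m) z1 mA.
rewrite f0 => H; rewrite -(cint_indic_null mA A0).
rewrite (eq_cint (b2 := fun t => \1_A (T m t) * poisson 0 t)); last first.
  move=> t tc; rewrite poisson0 mulr1 !indicE; congr ((nat_of_bool _)%:R).
  by apply/idP/idP => [/set_mem[_ At]|/set_mem At]; apply/mem_set.
by rewrite H; apply: eq_cint => t _; rewrite poisson0 mulr1.
Qed.

Lemma orb_null n (A : set R) : measurable A -> mu A = 0%E ->
  measurable (circ `&` orb 0 n @^-1` A) /\ mu (circ `&` orb 0 n @^-1` A) = 0%E.
Proof.
elim: n A => [|n IH] A mA A0; first exact: transfer_null.
have [mB B0] := @transfer_null n.+1 A mA A0.
have := IH _ mB B0; rewrite (_ : circ `&` orb 0 n @^-1` _ = circ `&` orb 0 n.+1 @^-1` A)//.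
apply/seteqP; split => t /= [tc]; first by case.
by move=> At; split => //; split => //; exact: orb_circ.
Qed.

Lemma orb_exceptional : exists Z : set R, mu.-negligible Z /\
  forall t, circ t -> ~ Z t ->
    forall n, fwd_comp (fun k => radial_ext (f k)) n (expi t) = expi (orb 0 n t).
Proof.
have Nn n : exists M : set R, [/\ measurable M, mu M = 0%E & N n `<=` M].
  by case: (fT n) => _ _ + _; exact.
have [M MP] := choice Nn.
(* The map f 0 acts on t itself and f n.+1 on [orb 0 n t], whence the shift of indices. Measurable
   hulls of the sets [N n] are taken so that [orb_null] applies. *)
exists (M 0%N `|` \bigcup_n (circ `&` orb 0 n @^-1` M n.+1)); split.
  apply: negligibleU.
    by have [mM M0 _] := MP 0%N; apply/negligibleP.
  apply: negligible_bigcup => n; have [mM M0 _] := MP n.+1.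
  by have [mB B0] := orb_null n mM M0; apply/negligibleP.
move=> t tc tZ; elim => [|n IH] /=.
  by apply: TE => // tN; apply: tZ; left; have [_ _] := MP 0%N; exact.
rewrite IH TE ?add0n//; first exact: orb_circ.
by move=> tN; apply: tZ; right; exists n => //; split => //; have [_ _] := MP n.+1; exact.
Qed.

Variable A : nat -> set R.
Hypothesis mA : forall n, measurable (A n).

(* Angles whose orbit, started at time [m], hits [A] infinitely often. *)
Definition tail_hits m : set R :=
  [set t | circ t /\ forall k, exists2 n, (k <= n)%N & A (m + n) (orb m n t)].

Lemma measurable_tail_hits m : measurable (tail_hits m).
Proof.
rewrite (_ : tail_hits m = circ `&` \bigcap_k \bigcup_(n in [set n | (k <= n)%N]) (orb m n @^-1` A (m + n))).
  apply: measurableI; first exact: measurable_circ.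
  apply: bigcap_measurable => // k _; apply: bigcup_measurable => n _.
  by rewrite -[X in measurable X]setTI; exact: measurable_orb.
apply/seteqP; split => t [tc H]; split => // k; last by have [n kn An] := H k I; exists n.
by move=> _; have [n kn An] := H k; exists n.
Qed.

Lemma tail_hitsE m t : circ t -> tail_hits m t <-> tail_hits m.+1 (T m t).
Proof.
move=> tc; split => -[_ H]; split => //.
- by case: (fT m).
(* Asking for indices above k + 1 rules out n = 0, which is not a time of the shifted orbit. *)
- move=> k; have [[//|n] kn An] := H k.+1.
  by exists n => //; rewrite addSnnS -orbS.
- by move=> k; have [n kn An] := H k; exists n.+1; [exact: leqW|rewrite orbS -addSnnS].
Qed.

Lemma cint_tail_hits m z : cabs z < 1 ->
  cint (fun t => \1_(tail_hits m) t * poisson z t) =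
  cint (fun t => \1_(tail_hits m.+1) t * poisson (f m z) t).
Proof.
move=> z1; rewrite -(poisson_transfer (@df m) (@f1 m) (fT m) z1 (measurable_tail_hits m.+1)).
apply: eq_cint => t tc; congr (_ * _); rewrite !indicE; congr ((nat_of_bool _)%:R).
by apply/idP/idP => /set_mem H; apply/mem_set; apply/(tail_hitsE m tc).
Qed.

Lemma cabs_fwd_comp n z : cabs z < 1 -> cabs (fwd_comp f n z) < 1.
Proof. by move=> z1; elim: n => [|n IH] /=; exact: f1. Qed.

Lemma cint_tail_hits_fwd n z : cabs z < 1 ->
  cint (fun t => \1_(tail_hits 0) t * poisson z t) =
  cint (fun t => \1_(tail_hits n.+1) t * poisson (fwd_comp f n z) t).
Proof.
move=> z1; elim: n => [|n ->] /=; first exact: cint_tail_hits.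
by apply: cint_tail_hits; exact: cabs_fwd_comp.
Qed.

Lemma fwd_comp0 n : fwd_comp f n 0 = 0.
Proof. by elim: n => [|n IH] /=; rewrite ?IH; exact: f0. Qed.

Lemma tail_hits_zero_one : contracting (fwd_comp f) ->
  mu (tail_hits 0) = 0%E \/ mu (circ `\` tail_hits 0) = 0%E.
Proof.
move=> cF; apply: (poisson_constant_zero_one (c := cint \1_(tail_hits 0))).
- exact: measurable_tail_hits.
- by move=> t [].
move=> z z1; apply/eqP; rewrite -subr_eq0 -normr_le0; apply/ler_addgt0Pl => e e0.
have z0 : cabs (0 : C) < 1 by rewrite cabs0.
have pi0 := pi_gt0 R.
(* 1/2 is the range of [poisson_near1]; the other term makes its bound, integrated over the circle,
   at most [e]. *)
pose d := Num.min (1 / 2) (e / (16 * (2 * pi))).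
have d0 : 0 < d by rewrite lt_min divr_gt0//= divr_gt0//; lra.
have [n nd] := contracting_to0 fwd_comp0 (fun n => cabs_fwd_comp n z1) cF z1 d0.
set w := fwd_comp f n z in nd.
have w1 : cabs w < 1 by exact: cabs_fwd_comp.
have [w2 w3] : cabs w <= 1 / 2 /\ 16 * cabs w * (2 * pi) <= e.
  move: nd; rewrite le_min => /andP[-> H]; split => //.
  by move: H; rewrite ler_pdivlMr; [lra|lra].
have bB : bmeas (\1_(tail_hits n.+1) : R -> R).
  by apply: bmeas_indic; exact: measurable_tail_hits.
have -> : cint \1_(tail_hits 0) = cint (fun t => \1_(tail_hits n.+1) t * poisson 0 t).
  rewrite -{1}(fwd_comp0 n) -(cint_tail_hits_fwd n z0).
  by apply: eq_cint => t _; rewrite poisson0 mulr1.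
rewrite (cint_tail_hits_fwd n z1) -/w.
rewrite -(cintB (bmeasM bB (bmeas_poisson w1)) (bmeasM bB (bmeas_poisson z0))).
rewrite addr0; apply: le_trans w3; apply: norm_cint_le.
  apply: bmeasB; apply: bmeasM => //; exact: bmeas_poisson.
move=> t _; rewrite poisson0 -mulrBr normrM -[leRHS]mul1r ler_pM//.
  by rewrite indicE; case: (_ \in _); rewrite ?mulr1n ?mulr0n ?normr1 ?normr0.
exact: poisson_near1.
Qed.

End orbits.

Theorem theoremB (R : realType) (f : nat -> (R[i])^o -> (R[i])^o)
    (I : nat -> set (R[i])^o)
    (f_inner : forall n, inner (f n))
    (f_centred : forall n, centred (f n))
    (F_contracting : contracting (fwd_comp f))
    (I_shrinking : shrinking_target I) :
  circle_null (unit_circle `\` hitting_set f I) \/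
  circle_null (hitting_set f I).
Proof.
have [T HT] := choice (fun n => inner_boundary_map (f_inner n)).
have [N HN] := choice HT.
have fT n := (HN n).1.
have TE n := (HN n).2.
pose A n := circle_angles (I n).
have mA n : measurable (A n) by apply: circle_angles_arc; case: I_shrinking.
have [Z [Z0 ZE]] := orb_exceptional f_inner f_centred fT TE.
pose B := tail_hits T A 0.
have mB : measurable B by exact: (measurable_tail_hits fT mA).
(* [hitting_set] follows the radial extensions themselves and [B] their measurable versions; the two
   orbits agree off [Z]. *)
have hitE t : circ t -> ~ Z t -> hitting_set f I (expi t) <-> B t.
  move=> tc tZ; split.
    move=> [_ H]; split => // k; have [n kn In] := H k; exists n => //.
    by split; [apply/circE; exact: (orb_circ fT)|rewrite add0n -ZE].
  move=> [_ H]; split; first by apply/unit_circleE; exact: cabs_expi.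
  move=> k; have [n kn [_ An]] := H k; exists n => //.
  by rewrite ZE.
have null (D : set R) : measurable D -> lebesgue_measure D = 0%E ->
    lebesgue_measure.-negligible (D `|` Z).
  by move=> mD D0; apply: negligibleU => //; apply/negligibleP.
have [B0|B1] := tail_hits_zero_one f_inner f_centred fT mA F_contracting.
  right; apply: negligibleS (null _ mB B0) => t [/circE tc Ht] /=.
  have [tZ|tZ] := pselect (Z t); first by right.
  by left; apply/hitE.
left.
have mCB : measurable (circ `\` B).
  by apply: measurableD => //; exact: measurable_circ.
apply: negligibleS (null _ mCB B1) => t [/circE tc [_ Ht]] /=.
have [tZ|tZ] := pselect (Z t); first by right.
by left; split => // /(hitE _ tc tZ).
Qed.
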